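(* Let $E$ be a Banach space and let $1\le p<\infty$. Then the following conditions are equivalent: (a) $E$ is finite-dimensional; (b) $\mathrm{FBL}^p[E]=H_{w^*}[E]$; (c) $H_{w^*}[E]\subseteq H^p[E]$; (d) $I[E]=H^p[E]$; (e) $I[E]=J_{w^*}^p[E]$; (f) $I[E]$ is closed in $H^p[E]$; (g) $\mathrm{FBL}^p[E]\subseteq I[E]$; (h) $I_{w^*}[E]=H_{w^*}[E]$; (i) $I_{w^*}[E]$ is closed in $H^p[E]$; (j) $\mathrm{FBL}^p[E]\subseteq I_{w^*}[E]$.
   Context: All Banach spaces are real. Let $E$ be a Banach space with dual $E^*$, and let $B_{E^*}$ be the closed unit ball of $E^*$. A function $f\colon E^*\to\mathbb{R}$ is positively homogeneous if $f(\lambda x^* )=\lambda f(x^* )$ for all $x^*\in E^*$ and $\lambda\in[0,\infty)$. $H[E]$ is the vector lattice of all positively homogeneous functions $E^*\to\mathbb{R}$ with pointwise operations. For $x\in E$, $\delta_x\in H[E]$ is $\delta_x(x^* )=x^*(x)$. For $x_1^*,\dots,x_n^*\in E^*$, set $\|(x_j^* )_{j=1}^n\|_{p,\mathrm{weak}}=\sup_{\|x\|\le1}\bigl(\sum_{j=1}^n|x_j^*(x)|^p\bigr)^{1/p}$, and for $f\in H[E]$ set $\|f\|_{\mathrm{FBL}^p[E]}=\sup\bigl\{\bigl(\sum_{j=1}^n|f(x_j^* )|^p\bigr)^{1/p}: n\in\mathbb{N},\ (x_j^* )_{j=1}^n\subset E^*,\ \|(x_j^* )_{j=1}^n\|_{p,\mathrm{weak}}\le1\bigr\}\in[0,\infty]$.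 - $H^p[E]=\{f\in H[E]:\|f\|_{\mathrm{FBL}^p[E]}<\infty\}$, a Banach lattice in the norm $\|\cdot\|_{\mathrm{FBL}^p[E]}$. - $\mathrm{FBL}^p[E]$ is the closed sublattice of $H^p[E]$ generated by $\{\delta_x:x\in E\}$. - $I[E]$ is the (order) ideal of $H[E]$ generated by $\{\delta_x:x\in E\}$; it is contained in $H^p[E]$. - $H_{w^*}[E]=\{f\in H[E]: f|_{B_{E^*}}\text{ is weak*-continuous}\}$. - $I_{w^*}[E]=I[E]\cap H_{w^*}[E]$. - $H_{w^*}^p[E]=H^p[E]\cap H_{w^*}[E]$. - $J_{w^*}^p[E]$ is the (order) ideal of $H^p[E]$ generated by $H_{w^*}^p[E]$. ''Closed in $H^p[E]$'' refers to the norm $\|\cdot\|_{\mathrm{FBL}^p[E]}$. *)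

(* Defs.v *)
From HB Require Import structures.
From mathcomp Require Import all_boot all_order all_algebra.
From mathcomp Require Import all_classical all_reals all_analysis.

Set Implicit Arguments.
Unset Strict Implicit.
Unset Printing Implicit Defensive.

Import Order.TTheory GRing.Theory Num.Theory numFieldNormedType.Exports.

Local Open Scope classical_set_scope.
Local Open Scope ring_scope.

Section Dual.
Context (R : realType) (E : normedModType R).

Definition finite_dimensional : Prop :=
  exists (n : nat) (v : 'I_n -> E),
    forall x : E, exists c : 'I_n -> R, x = \sum_(i < n) c i *: v i.

Definition is_dual : pred (E -> R^o) :=
  fun f => `[< linear f /\ continuous f >].

Fact is_dual_submod_closed : submod_closed is_dual.
Proof.
split=> [|a f g].
- by apply/asboolP; split=> [b x y|x] /=; [rewrite scaler0 addr0 | exact: cvg_cst].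
- move=> /asboolP[lf cf] /asboolP[lg cg]; apply/asboolP; split=> [b x y|x].
  + rewrite !fctE lf lg !scalerDr !scalerA mulrC addrACA; congr (_ + _).
  + by apply: cvgD; [apply: cvgZl_tmp; exact: cf | exact: cg].
Qed.

HB.instance Definition _ :=
  GRing.isSubmodClosed.Build R (E -> R^o) is_dual is_dual_submod_closed.

Record dual := Dual { dual_fun :> E -> R^o ; _ : is_dual dual_fun }.

HB.instance Definition _ := [isSub of dual for dual_fun].
HB.instance Definition _ := [Choice of dual by <:].
HB.instance Definition _ := [SubChoice_isSubLmodule of dual by <:].

Definition dual_norm (xs : dual) : \bar R :=
  ereal_sup [set `|xs x|%:E | x in [set x : E | `|x| <= 1]].

Definition dual_ball : set dual := [set xs | (dual_norm xs <= 1)%E].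

(* [dual] with the weak* topology: the coarsest topology making every
   evaluation [xs |-> xs x] continuous. *)
Definition weak_star_dual : Type :=
  initial_topology (dual_fun : dual -> {ptws E -> R^o}).
HB.instance Definition _ := Topological.on weak_star_dual.

End Dual.

(* Function spaces on E^* are represented as sets of functions [dual E -> R];
   all lattice operations on them are pointwise. *)
Section Lattices.
Context (R : realType) (T : Type).
Implicit Types L A S : set (T -> R).

Definition linear_subspace A : Prop :=
  A (fun=> 0) /\
  forall (a : R) f g, A f -> A g -> A (fun t => a * f t + g t).

Definition sublattice_of L A : Prop :=
  [/\ A `<=` L, linear_subspace A &
    forall f g, A f -> A g ->
      A (fun t => Num.max (f t) (g t)) /\ A (fun t => Num.min (f t) (g t))].

Definition order_ideal_of L A : Prop :=
  [/\ A `<=` L, linear_subspace A &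
    forall f g, L f -> A g -> (forall t, `|f t| <= `|g t|) -> A f].

Definition ideal_generated L S : set (T -> R) :=
  smallest (order_ideal_of L) S.

End Lattices.

Section FBL.
Context (R : realType) (p : R) (E : normedModType R).

Definition H_space : set (dual E -> R) :=
  [set f | forall (l : R) (xs : dual E), 0 <= l -> f (l *: xs) = l * f xs].

Definition delta (x : E) : dual E -> R := fun xs => xs x.

Definition deltas : set (dual E -> R) := range delta.

Definition weak_pnorm (n : nat) (xs : 'I_n -> dual E) : \bar R :=
  ereal_sup [set ((\sum_(j < n) `|xs j x| `^ p) `^ p^-1)%:E
            | x in [set x : E | `|x| <= 1]].

Definition FBL_norm (f : dual E -> R) : \bar R :=
  ereal_sup [set r | exists (n : nat) (xs : 'I_n -> dual E),
    (weak_pnorm xs <= 1)%E /\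
    r = ((\sum_(j < n) `|f (xs j)| `^ p) `^ p^-1)%:E].

Definition Hp_space : set (dual E -> R) :=
  [set f | H_space f /\ (FBL_norm f < +oo)%E].

Definition closed_in_Hp (A : set (dual E -> R)) : Prop :=
  forall f, Hp_space f ->
    (forall e : R, 0 < e ->
       exists2 g, A g & (FBL_norm (fun xs => (f xs - g xs)%R) < e%:E)%E) ->
    A f.

Definition FBL : set (dual E -> R) :=
  smallest (fun A => sublattice_of Hp_space A /\ closed_in_Hp A) deltas.

Definition I_space : set (dual E -> R) := ideal_generated H_space deltas.

Definition Hw_space : set (dual E -> R) :=
  [set f | H_space f /\
    {within (@dual_ball R E : set (weak_star_dual E)),
      continuous (f : weak_star_dual E -> R)}].

Definition Iw_space : set (dual E -> R) := I_space `&` Hw_space.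

Definition Hpw_space : set (dual E -> R) := Hp_space `&` Hw_space.

Definition Jpw_space : set (dual E -> R) := ideal_generated Hp_space Hpw_space.

End FBL.

Arguments H_space {R} E.
Arguments I_space {R} E.
Arguments Hw_space {R} E.
Arguments Iw_space {R} E.
Arguments deltas {R} E.
Arguments Hp_space {R} p E.
Arguments Hpw_space {R} p E.
Arguments Jpw_space {R} p E.
Arguments FBL {R} p E.

(* Main.v *)
Require Import Defs.
From HB Require Import structures.
From mathcomp Require Import all_boot all_order all_algebra.
From mathcomp Require Import all_classical all_reals all_analysis.
From mathcomp Require Import perm ring lra.

(** Positively homogeneous functions are compared with the evaluations [delta x].
    Such a function lies in the ideal I[E] iff it is dominated by a finite sum
    [sum_i |delta (x i)|], and I[E], the weak*-continuous functions, and their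
    intersections with H^p[E] are sublattices containing the evaluations; the
    weak*-continuous members of H^p[E] form a closed one, because the
    FBL^p-norm dominates the supremum over the dual ball. Hence
    FBL^p[E] always consists of weak*-continuous functions, and each condition
    other than finite dimension implies one of two: FBL^p[E] is contained in
    I[E], or every weak*-continuous positively homogeneous function lies in
    H^p[E].

    Hahn-Banach (proved with minimal sublinear functionals) shows that a
    biorthogonal system either is a basis with its coordinate functionals or
    can be extended. So E has a finite biorthogonal basis, or there is an
    infinite biorthogonal sequence [x i], [f i], with [x i] in the unit ball.

    If there is a finite basis, the l^1-norm of the coordinates is a member [u]
    of FBL^p[E] equivalent to the dual norm, so every positively homogeneous
    function bounded on the dual ball is dominated by a multiple of [u], and
    I[E] = H^p[E]. A
    weak*-continuous function is continuous on the compact sphere [u = 1], and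
    there it is uniformly approximated by finite minima of the functions
    [F t + K |a - t|], which extend to members of FBL^p[E]
    ([Hw_sub_FBL]).

    If there is an infinite biorthogonal sequence, both conditions fail.
    - [sum_k 2^-k |delta (x k)|] lies in FBL^p[E], but no finite sum of
      absolute values of evaluations dominates it, since some nonzero combination of the [f k]
      vanishes at any given finite set of points
      ([infinite_dimensional_FBL_nsub_I]).
    - For [n] functionals [f i], choose a finitely supported probability on the
      unit ball whose second-moment matrix [M], in the coordinates [f i], has
      nearly maximal determinant. Adding a small mass at a point [y] cannot
      increase the determinant much, which bounds [v^T M^-1 v] by [4 n], where
      [v = (f i y)_i]; its average over the probability is exactly [n]. The
      functionals [v_k^T M^-1 v], one for each point of the support, suitably
      weighted, are uniformly weakly p-summable with arbitrarily large sums of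
      p-th powers of norms ([dvoretzky_rogers]). The function
      [sum_k 2^-k max_j |delta (z_kj)|], where the [z_kj] are points at
      which such families take their large values, is a uniform limit of
      weak*-continuous functions on the ball and has infinite FBL^p-norm
      ([infinite_dimensional_Hw_nsub_Hp]). *)

Set Implicit Arguments.
Unset Strict Implicit.
Unset Printing Implicit Defensive.

Import Order.TTheory GRing.Theory Num.Theory numFieldNormedType.Exports.

Local Open Scope classical_set_scope.
Local Open Scope ring_scope.

(** * Continuous functionals *)

Section DualBasics.
Context {R : realType} {E : normedModType R}.
Implicit Types (f g : dual E) (x y : E).

Lemma dual_linear_continuous f : linear f /\ continuous f.
Proof. by case: f => f /= /asboolP. Qed.

Lemma dual_comb f c x y : f (c *: x + y) = c * f x + f y.
Proof. by have [l _] := dual_linear_continuous f; rewrite l. Qed.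

Lemma dual_at0 f : f 0 = 0.
Proof.
have := dual_comb f 1 0 0; rewrite scale1r add0r mul1r => /eqP.
by rewrite -subr_eq subrr eq_sym => /eqP.
Qed.

Lemma dual_atD f x y : f (x + y) = f x + f y.
Proof. by rewrite -[x in LHS]scale1r dual_comb mul1r. Qed.

Lemma dual_atZ f c x : f (c *: x) = c * f x.
Proof. by rewrite -[_ *: _]addr0 dual_comb dual_at0 addr0. Qed.

Lemma dual_atB f x y : f (x - y) = f x - f y.
Proof. by rewrite dual_atD -scaleN1r dual_atZ mulN1r. Qed.

Lemma dual_at_sum (I : Type) (r : seq I) f (c : I -> R) (v : I -> E) :
  f (\sum_(i <- r) c i *: v i) = \sum_(i <- r) c i * f (v i).
Proof.
elim: r => [|i r IH]; first by rewrite !big_nil dual_at0.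
by rewrite !big_cons dual_comb IH.
Qed.

Lemma dualDE f g x : (f + g) x = f x + g x. Proof. by []. Qed.
Lemma dualZE c f x : (c *: f) x = c * f x. Proof. by []. Qed.

Lemma dual_sumE (I : Type) (r : seq I) (F : I -> dual E) x :
  (\sum_(i <- r) F i) x = \sum_(i <- r) F i x.
Proof.
elim: r => [|i r IH]; first by rewrite !big_nil.
by rewrite !big_cons dualDE IH.
Qed.

Lemma dual_ext f g : f =1 g -> f = g.
Proof. by move=> fg; apply/val_inj/funext. Qed.

Lemma dual_boundP f : exists2 C, 0 <= C & forall x, `|f x| <= C * `|x|.
Proof.
have [lf cf] := dual_linear_continuous f.
pose lm := GRing.isLinear.Build R E R^o *:%R f lf.
pose F : {linear E -> R^o} := HB.pack (dual_fun f : E -> R^o) lm.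
have /linear_boundedP : bounded_near F (nbhs 0).
  exact/linear_bounded_continuous.
move=> /pinfty_ex_gt0 [C C0 CP].
by exists C => //; exact: ltW.
Qed.

Lemma bounded_linear_dual (F : E -> R) C :
  (forall c x y, F (c *: x + y) = c * F x + F y) ->
  (forall x, `|F x| <= C * `|x|) -> exists f : dual E, f =1 F.
Proof.
move=> lF bF.
have lF' : linear (F : E -> R^o) by move=> c x y; rewrite lF.
pose lm := GRing.isLinear.Build R E R^o *:%R F lF'.
pose G : {linear E -> R^o} := HB.pack (F : E -> R^o) lm.
have cG : continuous G.
  apply/linear_bounded_continuous/linear_boundedP.
  near=> r => x; apply: le_trans (bF x) _.
  by apply: ler_wpM2r => //; near: r; apply: nbhs_pinfty_ge; rewrite num_real.
have dF : is_dual (F : E -> R^o) by apply/asboolP; split.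
by exists (Dual dF).
Unshelve. all: by end_near. Qed.

End DualBasics.

(** * Enough functionals: the Hahn-Banach theorem *)

Section HahnBanach.
Context {R : realType} {E : normedModType R}.

(** Sublinear functionals dominated by the norm. A linear functional below one
    of them is continuous. *)
Definition dominated_sublinear (q : E -> R) : Prop :=
  [/\ forall x y, q (x + y) <= q x + q y,
      forall c x, 0 <= c -> q (c *: x) = c * q x &
      forall x, q x <= `|x|].

Lemma dominated_sublinear0 q : dominated_sublinear q -> q 0 = 0.
Proof. by case=> _ h _; rewrite -(scale0r 0) h// mul0r. Qed.

Lemma dominated_sublinear_lb q x : dominated_sublinear q -> - `|x| <= q x.
Proof.
move=> Q; have [s h d] := Q; have := s x (- x); rewrite subrr dominated_sublinear0//.
by have := d (- x); rewrite normrN; lra.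
Qed.

(** The infimum over [t >= 0] of [q (x + t y) - t q y] is sublinear, below
    [q], and takes at [- y] a value at most [- q y]. *)
Lemma sublinear_lower q y : dominated_sublinear q ->
  exists2 q', dominated_sublinear q' &
    (forall x, q' x <= q x) /\ q' (- y) <= - q y.
Proof.
move=> Q; have [s h d] := Q.
pose A x := [set q (x + t *: y) - t * q y | t in [set t | 0 <= t]].
have Alb x : lbound (A x) (- q (- x)).
  move=> _ /= [t t0 <-]; have := s (x + t *: y) (- x).
  by rewrite addrAC subrr add0r h//; lra.
have AI x : has_inf (A x).
  split; last by exists (- q (- x)); exact: Alb.
  by exists (q (x + 0 *: y) - 0 * q y); exists 0 => /=.
have inf_le x t : 0 <= t -> inf (A x) <= q (x + t *: y) - t * q y.
  by move=> t0; apply: ge_inf; [exact: (AI x).2|exists t].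
have le_inf' x r : (forall t, 0 <= t -> r <= q (x + t *: y) - t * q y) ->
    r <= inf (A x).
  move=> H; apply: lb_le_inf; first exact: (AI x).1.
  by move=> _ [t /= t0 <-]; exact: H.
have infq x : inf (A x) <= q x.
  by have := inf_le x 0 (lexx _); rewrite scale0r addr0 mul0r subr0.
have infZ c x : 0 < c -> c * inf (A x) <= inf (A (c *: x)).
  move=> c0; apply/le_inf' => t t0.
  have := inf_le x (t / c) (divr_ge0 t0 (ltW c0)).
  rewrite -(ler_pM2l c0) => /le_trans; apply.
  rewrite mulrBr -(h _ _ (ltW c0)) scalerDr scalerA.
  have ct : c * (t / c) = t by rewrite mulrC divfK ?gt_eqF.
  by rewrite ct mulrA ct.
exists (fun x => inf (A x)); last first.
  split=> //; have := inf_le (- y) 1 ler01.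
  by rewrite scale1r addNr dominated_sublinear0// mul1r sub0r.
split.
- move=> x1 x2; rewrite -lerBlDr; apply/le_inf' => t t0.
  rewrite lerBlDr -lerBlDl; apply/le_inf' => u u0.
  have := inf_le (x1 + x2) (t + u) (addr_ge0 t0 u0).
  have := s (x1 + t *: y) (x2 + u *: y); rewrite addrACA -scalerDl; lra.
- move=> c x; rewrite le_eqVlt => /predU1P[<-|c0].
    rewrite scale0r mul0r; apply/eqP; rewrite eq_le; apply/andP; split.
      by have := infq 0; rewrite dominated_sublinear0.
    by apply/le_inf' => t t0; rewrite add0r h// subrr.
  apply/eqP; rewrite eq_le infZ// andbT.
  have ci : 0 < c^-1 by rewrite invr_gt0.
  have := infZ _ (c *: x) ci; rewrite scalerA mulVf ?gt_eqF// scale1r.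
  by rewrite -(ler_pM2l c0) mulrA divff ?gt_eqF// mul1r.
- by move=> x; exact: le_trans (infq x) (d x).
Qed.

(** Below any sublinear functional there is a minimal one, by Zorn's lemma: the
    infimum of a chain is sublinear. *)
Lemma minimal_sublinear q0 : dominated_sublinear q0 ->
  exists2 q, dominated_sublinear q &
    (forall x, q x <= q0 x) /\
    forall q', dominated_sublinear q' -> (forall x, q' x <= q x) -> q' = q.
Proof.
move=> Q0.
pose P (q : E -> R) := dominated_sublinear q /\ forall x, q x <= q0 x.
pose T := {q : E -> R | P q}.
pose Rel (a b : T) := `[< forall x, sval b x <= sval a x >].
have [||||m mmax] := @Zorn T Rel.
- by move=> t; apply/asboolP.
- move=> r s t /asboolP rs /asboolP st; apply/asboolP => x.
  exact: le_trans (st x) (rs x).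
- move=> [s Ps] [t Pt] /asboolP /= st /asboolP /= ts; apply: eq_exist.
  by apply/funext => x; apply/eqP; rewrite eq_le st ts.
- move=> A Atot.
  have [[a0 Aa0]|A0] := pselect (A !=set0); last first.
    exists (exist P q0 (conj Q0 (fun x => lexx _))) => s As.
    by exfalso; apply: A0; exists s.
  pose V x := [set sval a x | a in A].
  have VI x : has_inf (V x).
    split; first by exists (sval a0 x), a0.
    exists (- `|x|) => _ [a _ <-].
    by apply: dominated_sublinear_lb; case: (svalP a).
  have infV a x : A a -> inf (V x) <= sval a x.
    by move=> Aa; apply: ge_inf; [exact: (VI x).2|exists a].
  have Vinf x r : (forall a, A a -> r <= sval a x) -> r <= inf (V x).
    move=> H; apply: lb_le_inf; first exact: (VI x).1.
    by move=> _ [a Aa <-]; exact: H.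
  have Q : dominated_sublinear (fun x => inf (V x)).
    split.
    + move=> x y; rewrite -lerBlDr; apply/Vinf => a Aa.
      rewrite lerBlDr -lerBlDl; apply/Vinf => b Ab.
      have [[sa _ _] _] := svalP a; have [[sb _ _] _] := svalP b.
      have := infV _ (x + y) Aa; have := infV _ (x + y) Ab.
      have := sa x y; have := sb x y.
      by case: (Atot a b Aa Ab) => /asboolP ab; have := ab x; have := ab y; lra.
    + move=> c x c0; apply/eqP; rewrite eq_le; apply/andP; split.
        move: c0; rewrite [0 <= c]le_eqVlt => /predU1P[<-|c0].
          rewrite scale0r mul0r; apply: le_trans (infV _ 0 Aa0) _.
          by rewrite dominated_sublinear0//; case: (svalP a0).
        rewrite mulrC -ler_pdivrMr//; apply/Vinf => a Aa.
        rewrite ler_pdivrMr// mulrC.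
        have [[_ ha _] _] := svalP a; rewrite -(ha _ _ (ltW c0)); exact: infV.
      apply/Vinf => a Aa; have [[_ ha _] _] := svalP a; rewrite ha//.
      by apply: ler_wpM2l => //; exact: infV.
    + move=> x; apply: le_trans (infV _ x Aa0) _.
      by have [[_ _ da] _] := svalP a0.
  have Q' x : inf (V x) <= q0 x.
    by apply: le_trans (infV _ x Aa0) _; have [_ ->] := svalP a0.
  pose m : T := exist P (fun x => inf (V x)) (conj Q Q').
  by exists m => s As; apply/asboolP => x /=; exact: infV.
exists (sval m); first by case: (svalP m).
have [Qm mq0] := svalP m; split => // q' Q' q'm.
have q'0 x : q' x <= q0 x by exact: le_trans (q'm x) (mq0 x).
pose t : T := exist P q' (conj Q' q'0).
by have /(congr1 sval) := mmax t (asboolT q'm).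
Qed.

(** Starting from the functional [sublinear_lower w] below the norm forces the
    value of the linear functional at [w] to be at least [|w|]. *)
Lemma hahn_banach (w : E) : w != 0 -> exists f : dual E, f w != 0.
Proof.
move=> w0.
have Qn : dominated_sublinear (fun x : E => `|x|).
  by split=> [x y|c x c0|x] //; [exact: ler_normD|rewrite normrZ ger0_norm].
have [q1 Q1 [_ q1w]] := sublinear_lower w Qn.
have [q Q [qq1 qmin]] := minimal_sublinear Q1.
have [s h d] := Q.
(* Minimality identifies [q] with the functional of [sublinear_lower y]. *)
have qN y : q (- y) = - q y.
  have [q' Q' [q'q q'y]] := sublinear_lower y Q.
  have qE := qmin _ Q' q'q; rewrite qE in q'y.
  by have := s y (- y); rewrite subrr dominated_sublinear0//; lra.
have qD x y : q (x + y) = q x + q y.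
  apply/eqP; rewrite eq_le s/=.
  by have := s (x + y) (- y); rewrite addrK qN; lra.
have qZ c x : q (c *: x) = c * q x.
  have [c0|c0] := leP 0 c; first exact: h.
  have c0' : 0 <= - c by rewrite oppr_ge0 ltW.
  by rewrite -[c *: x]opprK -scaleNr qN (h _ _ c0') mulNr opprK.
have [f fE] : exists f : dual E, f =1 q.
  apply: (@bounded_linear_dual _ _ q 1) => [c x y|x]; first by rewrite qD qZ.
  by rewrite mul1r ler_norml d andbT dominated_sublinear_lb.
exists f; rewrite fE; apply/negP => /eqP qw.
have : 0 < `|w| by rewrite normr_gt0.
by have := qq1 (- w); rewrite qN qw; lra.
Qed.

End HahnBanach.

(** * Biorthogonal systems *)

Section Biorthogonal.
Context {R : realType} {E : normedModType R}.

(** The new vector is the residual of some [z] outside the span, on which all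
    present functionals vanish; the new functional comes from one that does not
    vanish there, corrected along the present system. *)
Lemma biorthogonal_extend (s : seq (E * dual E)) :
  (forall i j, (i < size s)%N -> (j < size s)%N ->
     (nth 0 s i).2 (nth 0 s j).1 = (i == j)%:R) ->
  (forall z, z = \sum_(i < size s) (nth 0 s i).2 z *: (nth 0 s i).1) \/
  exists q : E * dual E, [/\ `|q.1| <= 1, q.2 q.1 = 1,
    forall i, (i < size s)%N -> (nth 0 s i).2 q.1 = 0 &
    forall i, (i < size s)%N -> q.2 (nth 0 s i).1 = 0].
Proof.
move=> sP; pose P z := z - \sum_(i < size s) (nth 0 s i).2 z *: (nth 0 s i).1.
have [spans|/existsNP[z zP]] :=
    pselect (forall z, z = \sum_(i < size s) (nth 0 s i).2 z *: (nth 0 s i).1).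
  by left.
right; have Pz0 : P z != 0 by rewrite subr_eq0; apply/eqP.
have sPz i : (i < size s)%N -> (nth 0 s i).2 (P z) = 0.
  move=> si; rewrite /P dual_atB dual_at_sum (bigD1 (Ordinal si))//=.
  rewrite sP// eqxx mulr1 big1 ?addr0 ?subrr// => j ji.
  rewrite sP//; case: eqP => [ij|]; last by rewrite mulr0.
  by move/eqP: ji; case; apply/val_inj.
have [f fPz] := hahn_banach Pz0.
pose n : R := `|P z|; have n0 : 0 < n by rewrite normr_gt0.
pose g := (n / f (P z)) *: (f - \sum_(i < size s) f (nth 0 s i).1 *: (nth 0 s i).2).
have gE x : g x = n / f (P z) * (f x - \sum_(i < size s) f (nth 0 s i).1 * (nth 0 s i).2 x).
  rewrite /g dualZE; congr (_ * _); rewrite -[in LHS]scaleN1r addrC dualDE dualZE.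
  by rewrite dual_sumE mulN1r addrC.
clearbody g.
exists (n^-1 *: P z, g); split => /=.
- by rewrite normrZ gtr0_norm ?invr_gt0// mulVf// gt_eqF.
- rewrite dual_atZ gE big1 ?subr0; last by move=> i _; rewrite sPz// mulr0.
  by rewrite mulfVK// mulVf// gt_eqF.
- by move=> i si; rewrite dual_atZ sPz// mulr0.
- move=> i si; rewrite gE (bigD1 (Ordinal si))//= sP// eqxx mulr1.
  rewrite big1 ?addr0 ?subrr ?mulr0// => j ji.
  rewrite sP//; case: eqP => [ij|]; last by rewrite mulr0.
  by move/eqP: ji; case; apply/val_inj.
Qed.

(** Either some finite biorthogonal system is a basis of the space, together
    with its coordinate functionals, or the construction of biorthogonal
    systems never stops. *)
Lemma biorthogonal_dichotomy :
  (exists (n : nat) (x : 'I_n -> E) (f : 'I_n -> dual E),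
     (forall i j, f i (x j) = (i == j)%:R) /\
     forall z, z = \sum_(i < n) f i z *: x i) \/
  (exists (x : nat -> E) (f : nat -> dual E),
     (forall i, `|x i| <= 1) /\ forall i j, f i (x j) = (i == j)%:R).
Proof.
pose B (s : seq (E * dual E)) := forall i j, (i < size s)%N -> (j < size s)%N ->
  (nth 0 s i).2 (nth 0 s j).1 = (i == j)%:R.
pose spans (s : seq (E * dual E)) :=
  forall z, z = \sum_(i < size s) (nth 0 s i).2 z *: (nth 0 s i).1.
have [[s [Bs ss]]|noS] := pselect (exists s, B s /\ spans s).
  left; exists (size s), (fun i => (nth 0 s i).1), (fun i => (nth 0 s i).2).
  by split=> // i j; rewrite Bs.
right.
have /choice[g gP] : forall s, exists q : E * dual E, B s ->
    [/\ `|q.1| <= 1, q.2 q.1 = 1,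
    forall i, (i < size s)%N -> (nth 0 s i).2 q.1 = 0 &
    forall i, (i < size s)%N -> q.2 (nth 0 s i).1 = 0].
  move=> s; have [Bs|] := pselect (B s); last by exists 0.
  have [ss|[q qP]] := biorthogonal_extend Bs; last by exists q.
  by exfalso; apply: noS; exists s.
pose S k := iter k (fun s => rcons s (g s)) [::].
have sizeS k : size (S k) = k by elim: k => //= k IH; rewrite size_rcons IH.
have nthS k i : (i < k)%N -> nth 0 (S k) i = g (S i).
  elim: k => // k IH; rewrite ltnS leq_eqVlt => /predU1P[->|ik] /=.
    by rewrite nth_rcons sizeS ltnn eqxx.
  by rewrite nth_rcons sizeS ik IH.
have BS k : B (S k).
  elim: k => // k IH i j; rewrite sizeS !ltnS.
  have [_ g1 gl gr] := gP _ IH.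
  rewrite leq_eqVlt => /predU1P[->|ik]; rewrite leq_eqVlt => /predU1P[->|jk].
  - by rewrite nthS// g1 eqxx.
  - rewrite nthS// nthS; last exact: ltnW.
    by rewrite -(nthS k j)// gr ?sizeS// gtn_eqF.
  - rewrite nthS; last exact: ltnW.
    by rewrite nthS// -(nthS k i)// gl ?sizeS// ltn_eqF.
  - rewrite nthS; last exact: ltnW.
    rewrite nthS; last exact: ltnW.
    by rewrite -(nthS k i)// -(nthS k j)// IH ?sizeS.
exists (fun i => (g (S i)).1), (fun i => (g (S i)).2); split=> [i|i j].
  by have [] := gP _ (BS i).
pose k := (maxn i j).+1.
have ik : (i < k)%N by rewrite ltnS leq_maxl.
have jk : (j < k)%N by rewrite ltnS leq_maxr.
by rewrite -(nthS k i)// -(nthS k j)// BS// sizeS.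
Qed.

Lemma spanning_finite_dimensional n (x : 'I_n -> E) (f : 'I_n -> dual E) :
  (forall z, z = \sum_(i < n) f i z *: x i) -> finite_dimensional E.
Proof. by move=> H; exists n, x => z; exists (fun i => f i z). Qed.

(** Any [m] points are annihilated by a nonzero combination of any [m.+1]
    functionals. *)
Lemma annihilating_combination m (y : 'I_m -> E) (f : 'I_m.+1 -> dual E) :
  exists a : 'I_m.+1 -> R, (exists i, a i != 0) /\
    forall l, (\sum_(i < m.+1) a i *: f i) (y l) = 0.
Proof.
pose A := \matrix_(i < m.+1, l < m) f i (y l).
have : kermx A != 0.
  rewrite -mxrank_eq0 mxrank_ker subn_eq0 -ltnNge ltnS; exact: rank_leq_col.
move=> /rowV0Pn[v /sub_kermxP vA v0].
exists (fun i => v 0 i); split.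
  move: v0; apply: contraNP => /forallNP H; apply/eqP/rowP => i.
  by rewrite mxE; apply/eqP; apply/negPn/negP => /H.
move=> l; move/rowP: vA => /(_ l); rewrite !mxE => vAl.
by rewrite dual_sumE -[RHS]vAl; apply: eq_bigr => i _; rewrite mxE.
Qed.

Lemma infinite_biorthogonal_infinite_dimensional (x : nat -> E) (f : nat -> dual E) :
  (forall i j, f i (x j) = (i == j)%:R) -> ~ finite_dimensional E.
Proof.
move=> fx [m [v vP]].
have [a [[i ai] av]] := annihilating_combination v (fun i : 'I_m.+1 => f i).
have [c xc] := vP (x i); have : (\sum_(i < m.+1) a i *: f i) (x i) = 0.
  by rewrite xc dual_at_sum big1// => l _; rewrite av mulr0.
rewrite dual_sumE (bigD1 i)// dualZE fx eqxx mulr1 big1 => [|j ji].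
  by rewrite /= addr0 => ai0; rewrite ai0 eqxx in ai.
rewrite dualZE fx; case: eqP => [/val_inj ij|]; last by rewrite mulr0.
by rewrite ij eqxx in ji.
Qed.

End Biorthogonal.

(** * The norm of FBL^p and the lattice H^p *)

Section PowR.
Context {R : realType}.

Lemma powR_inv_le (p s C : R) : 1 <= p -> 0 <= s -> 0 <= C ->
  (s `^ p^-1 <= C) = (s <= C `^ p).
Proof.
move=> p1 s0 C0; have p0 : 0 < p by apply: lt_le_trans p1.
have pi0 : 0 <= p^-1 by rewrite invr_ge0 ltW.
have sE : (s `^ p^-1) `^ p = s by rewrite -powRrM mulVf ?gt_eqF// powRr1.
have CE : (C `^ p) `^ p^-1 = C by rewrite -powRrM mulfV ?gt_eqF// powRr1.
apply/idP/idP => H.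
  by rewrite -sE; apply: ge0_ler_powR; rewrite ?nnegrE ?powR_ge0// ltW.
by rewrite -CE; apply: ge0_ler_powR; rewrite ?nnegrE ?powR_ge0.
Qed.

Lemma powR_convex_combination (p w1 w2 x y : R) : 1 <= p ->
  0 <= w1 -> 0 <= w2 -> w1 + w2 = 1 -> 0 <= x -> 0 <= y ->
  (w1 * x + w2 * y) `^ p <= w1 * x `^ p + w2 * y `^ p.
Proof.
move=> p1 w10 w20 w12 x0 y0.
have w11 : w1 <= 1 by lra.
have /(_ x y) := @convex_powR R p p1 (Itv01 w10 w11).
rewrite !inE/= !in_itv/= !andbT => /(_ x0 y0).
have w2E : 1 - w1 = w2 by lra.
by rewrite ![conv _ _ _]convRE/= /unstable.onem w2E.
Qed.

(** Minkowski's inequality for finite sums. *)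
Lemma sum_powR_minkowski (p : R) (I : finType) (a b : I -> R) A B : 1 <= p ->
  0 < A -> 0 < B ->
  \sum_i `|a i| `^ p <= A `^ p -> \sum_i `|b i| `^ p <= B `^ p ->
  \sum_i `|a i + b i| `^ p <= (A + B) `^ p.
Proof.
move=> p1 A0 B0 aA bB; have AB0 : 0 < A + B by exact: addr_gt0.
have p0 : 0 <= p by apply: le_trans p1.
have pw i : `|a i + b i| `^ p <= (A + B) `^ p *
    (A / (A + B) * (`|a i| `^ p / A `^ p) + B / (A + B) * (`|b i| `^ p / B `^ p)).
  have dvp x C : 0 < C -> `|x| `^ p / C `^ p = (`|x| / C) `^ p.
    move=> C0; rewrite powRM ?invr_ge0 ?(ltW C0)//; congr (_ * _).
    by rewrite -powRN -mulN1r powRrM powR_inv1// ltW.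
  rewrite !dvp//.
  apply: (@le_trans _ _ ((A + B) `^ p *
    (A / (A + B) * (`|a i| / A) + B / (A + B) * (`|b i| / B)) `^ p)).
    have c0 : 0 <= A / (A + B) * (`|a i| / A) + B / (A + B) * (`|b i| / B).
      by rewrite addr_ge0// mulr_ge0// divr_ge0// ltW.
    rewrite -(powRM _ (ltW AB0) c0).
    apply: ge0_ler_powR => //; rewrite ?nnegrE//.
      by rewrite mulr_ge0// ltW.
    rewrite [leRHS](_ : _ = `|a i| + `|b i|) ?ler_normD//.
    by field; rewrite !gt_eqF.
  apply: ler_wpM2l; first exact: powR_ge0.
  apply: powR_convex_combination => //.
  - by rewrite divr_ge0 ?(ltW A0) ?(ltW AB0).
  - by rewrite divr_ge0 ?(ltW B0) ?(ltW AB0).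
  - by rewrite -mulrDl divff ?gt_eqF.
  - by rewrite divr_ge0 ?(ltW A0).
  - by rewrite divr_ge0 ?(ltW B0).
apply: le_trans (ler_sum _ (fun i _ => pw i)) _.
rewrite -mulr_sumr big_split/= -!mulr_sumr -!mulr_suml.
rewrite -[leRHS]mulr1; apply: ler_wpM2l; first exact: powR_ge0.
rewrite [leRHS](_ : 1 = A / (A + B) * 1 + B / (A + B) * 1); last first.
  by rewrite !mulr1 -mulrDl divff ?gt_eqF.
apply: lerD; apply: ler_wpM2l; rewrite ?divr_ge0 ?(ltW A0) ?(ltW B0) ?(ltW AB0)//.
  by rewrite ler_pdivrMr ?powR_gt0// mul1r.
by rewrite ler_pdivrMr ?powR_gt0// mul1r.
Qed.

End PowR.

Section FBLnorm.
Context {R : realType} {p : R} {E : normedModType R} (p1 : 1 <= p).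
Implicit Types (f g : dual E -> R).

Let p_gt0 : 0 < p. Proof. exact: lt_le_trans p1. Qed.
Let p_ge0 : 0 <= p. Proof. exact: ltW. Qed.

(** The finite families with weak p-norm at most 1; the p-th root in the norm
    is dropped, here and in [FBL_bound]. *)
Definition weakly_contractive n (xs : 'I_n -> dual E) :=
  forall x : E, `|x| <= 1 -> \sum_(j < n) `|xs j x| `^ p <= 1.

(** For [0 <= C], the FBL^p-norm of [f] is at most [C]. *)
Definition FBL_bound f C := forall n (xs : 'I_n -> dual E),
  weakly_contractive xs -> \sum_(j < n) `|f (xs j)| `^ p <= C `^ p.

Lemma sum_powR_ge0 n (a : 'I_n -> R) : 0 <= \sum_(j < n) `|a j| `^ p.
Proof. by apply: sumr_ge0 => j _; exact: powR_ge0. Qed.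

Lemma weak_pnorm_le1 n (xs : 'I_n -> dual E) :
  (weak_pnorm p xs <= 1)%E <-> weakly_contractive xs.
Proof.
split=> [H x x1|H].
  have : (((\sum_(j < n) `|xs j x| `^ p) `^ p^-1)%:E <= 1)%E.
    by apply: le_trans H; apply: ereal_sup_ubound; exists x.
  by rewrite lee_fin powR_inv_le ?sum_powR_ge0// powR1.
apply: ge_ereal_sup => _ [x /= x1 <-].
by rewrite lee_fin powR_inv_le ?sum_powR_ge0// powR1 H.
Qed.

Lemma FBL_norm_leP f C : 0 <= C ->
  (FBL_norm p f <= C%:E)%E <-> FBL_bound f C.
Proof.
move=> C0; split=> [H n xs /weak_pnorm_le1 xs1|H].
  rewrite -powR_inv_le ?sum_powR_ge0// -lee_fin; apply: le_trans H.
  by apply: ereal_sup_ubound; exists n, xs.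
apply: ge_ereal_sup => _ [n [xs [/weak_pnorm_le1 xs1 ->]]].
by rewrite lee_fin powR_inv_le ?sum_powR_ge0// H.
Qed.

Lemma Hp_spaceP f : Hp_space p E f <-> H_space E f /\ exists2 C, 0 <= C & FBL_bound f C.
Proof.
split=> [[Hf fp]|[Hf [C C0 /FBL_norm_leP fC]]]; last first.
  by split=> //; apply: le_lt_trans (fC C0) _; exact: ltry.
split=> //.
have N0 : (0 <= FBL_norm p f)%E.
  apply: ereal_sup_ubound; exists 0, (fun=> 0); split.
    by apply/weak_pnorm_le1 => x _; rewrite big_ord0.
  by rewrite big_ord0 powR0// invr_eq0 gt_eqF.
have Nfin : FBL_norm p f \is a fin_num by rewrite ge0_fin_numE.
exists (fine (FBL_norm p f)); first exact: fine_ge0.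
by apply/FBL_norm_leP; rewrite ?fine_ge0// fineK.
Qed.

Lemma closed_in_HpP (A : set (dual E -> R)) :
  closed_in_Hp p A <-> forall f, Hp_space p E f ->
    (forall e, 0 < e -> exists2 g, A g & FBL_bound (fun xs => f xs - g xs) e) -> A f.
Proof.
split=> H f Hf fA; apply: H => // e e0.
  have [|g Ag gP] := fA (e / 2); first by rewrite divr_gt0.
  exists g => //; move/FBL_norm_leP : gP => /(_ _)/le_lt_trans; apply.
    by rewrite divr_ge0// ltW.
  by rewrite lte_fin ltr_pdivrMr// ltr_pMr// ltr1n.
have [g Ag /ltW gP] := fA _ e0.
by exists g => //; apply/FBL_norm_leP => //; exact: ltW.
Qed.

Lemma dual_ballP (xs : dual E) :
  dual_ball xs <-> forall x, `|x| <= 1 -> `|xs x| <= 1.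
Proof.
split=> [H x x1|H].
  by rewrite -lee_fin; apply: le_trans H; apply: ereal_sup_ubound; exists x.
by apply: ge_ereal_sup => _ [x /= x1 <-]; rewrite lee_fin H.
Qed.

(** A single functional of the dual ball is a weakly contractive family. *)
Lemma FBL_bound_ball f C xs : 0 <= C -> FBL_bound f C -> dual_ball xs -> `|f xs| <= C.
Proof.
move=> C0 fC /dual_ballP xs1; have := fC 1 (fun=> xs); rewrite big_ord1.
have powK (a : R) : 0 <= a -> (a `^ p) `^ p^-1 = a.
  by move=> a0; rewrite -powRrM mulfV ?gt_eqF// powRr1.
rewrite -powR_inv_le ?powR_ge0// powK//; apply => x x1.
have one : 1 = 1 `^ p :> R by rewrite powR1.
rewrite big_ord1 one; apply: ge0_ler_powR; rewrite ?nnegrE//.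
exact: xs1.
Qed.

End FBLnorm.

Section BoundRules.
Context {R : realType} {p : R} {E : normedModType R} (p1 : 1 <= p).
Implicit Types (f g : dual E -> R).

Let p_gt0 : 0 < p. Proof. exact: lt_le_trans p1. Qed.
Let p_ge0 : 0 <= p. Proof. exact: ltW. Qed.

Lemma FBL_bound_solid f g C : (forall xs, `|f xs| <= `|g xs|) ->
  FBL_bound (p := p) g C -> FBL_bound (p := p) f C.
Proof.
move=> fg gC n xs /gC; apply: le_trans; apply: ler_sum => j _.
by apply: ge0_ler_powR; rewrite ?nnegrE.
Qed.

Lemma FBL_bound_le f C C' : 0 <= C -> C <= C' ->
  FBL_bound (p := p) f C -> FBL_bound (p := p) f C'.
Proof.
move=> C0 CC' fC n xs /fC/le_trans; apply.
by apply: ge0_ler_powR; rewrite ?nnegrE// (le_trans C0).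
Qed.

Lemma FBL_boundD f g A B : 0 < A -> 0 < B ->
  FBL_bound (p := p) f A -> FBL_bound (p := p) g B ->
  FBL_bound (p := p) (fun xs => f xs + g xs) (A + B).
Proof.
move=> A0 B0 fA gB n xs xs1; apply: sum_powR_minkowski => //.
  exact: fA.
exact: gB.
Qed.

Lemma FBL_boundZ f c C : 0 <= C -> FBL_bound (p := p) f C ->
  FBL_bound (p := p) (fun xs => c * f xs) (`|c| * C).
Proof.
move=> C0 fC n xs /fC H; rewrite powRM//.
under eq_bigr do rewrite normrM powRM//.
by rewrite -mulr_sumr; apply: ler_wpM2l => //; exact: powR_ge0.
Qed.

Lemma FBL_bound_delta (x : E) : FBL_bound (p := p) (@delta R E x) `|x|.
Proof.
move=> n xs xs1; have [->|x0] := eqVneq x 0.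
  rewrite normr0 powR0 ?gt_eqF// big1// => j _.
  by rewrite /delta dual_at0 normr0 powR0 ?gt_eqF.
have nx : 0 < `|x| by rewrite normr_gt0.
have := xs1 (`|x|^-1 *: x); rewrite normrZ gtr0_norm ?invr_gt0// mulVf ?gt_eqF//.
move=> /(_ (lexx _)) H.
rewrite -[leRHS]mulr1; apply: le_trans (ler_wpM2l (powR_ge0 _ _) H).
rewrite mulr_sumr; apply: ler_sum => j _.
by rewrite -powRM// dual_atZ normrM gtr0_norm ?invr_gt0// mulVKf ?gt_eqF.
Qed.

End BoundRules.

(** * Ideals and sublattices *)

Section LinearSubspaces.
Context {R : realType} {T : Type}.
Implicit Types (A : set (T -> R)).

Lemma linear_subspaceD A f g : linear_subspace A -> A f -> A g ->
  A (fun t => f t + g t).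
Proof.
move=> [_ H] Af Ag; have := H 1 f g Af Ag.
by rewrite (_ : (fun _ => _) = (fun t => f t + g t))//; apply/funext => t; rewrite mul1r.
Qed.

Lemma linear_subspaceZ A c f : linear_subspace A -> A f -> A (fun t => c * f t).
Proof.
move=> [H0 H] Af; have := H c f _ Af H0.
by rewrite (_ : (fun _ => _) = (fun t => c * f t))//; apply/funext => t; rewrite addr0.
Qed.

Lemma linear_subspaceB A f g : linear_subspace A -> A f -> A g ->
  A (fun t => f t - g t).
Proof.
move=> L Af Ag; have := linear_subspaceD L Af (linear_subspaceZ (- 1) L Ag).
by rewrite (_ : (fun _ => _) = (fun t => f t - g t))//; apply/funext => t; rewrite mulN1r.
Qed.

Lemma linear_subspace_sum A (I : Type) (r : seq I) (F : I -> T -> R) :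
  linear_subspace A -> (forall i, A (F i)) -> A (fun t => \sum_(i <- r) F i t).
Proof.
move=> L AF; elim: r => [|i r IH].
  by rewrite (_ : (fun _ => _) = (fun=> 0)); [exact: L.1|apply/funext => t; rewrite big_nil].
rewrite (_ : (fun _ => _) = (fun t => F i t + \sum_(j <- r) F j t)).
  exact: linear_subspaceD.
by apply/funext => t; rewrite big_cons.
Qed.

Lemma sublattice_abs L A f : sublattice_of L A -> A f -> A (fun t => `|f t|).
Proof.
move=> [_ lA mA] Af; have := (mA f _ Af (linear_subspaceZ (- 1) lA Af)).1.
rewrite (_ : (fun _ => _) = (fun t => `|f t|))//; apply/funext => t.
by rewrite mulN1r maxrN.
Qed.

Lemma sublatticeI L A B : sublattice_of L A ->
  linear_subspace B -> (forall f g, B f -> B g ->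
    B (fun t => Num.max (f t) (g t)) /\ B (fun t => Num.min (f t) (g t))) ->
  sublattice_of L (A `&` B).
Proof.
move=> [AL [A0 lA] mA] [B0 lB] mB; split.
- by move=> f [/AL].
- by split=> // c f g [? ?] [? ?]; split; [exact: lA|exact: lB].
- move=> f g [Af Bf] [Ag Bg].
  by have [? ?] := mA f g Af Ag; have [? ?] := mB f g Bf Bg; split; split.
Qed.

End LinearSubspaces.

Section Ideals.
Context {R : realType} {p : R} {E : normedModType R} (p1 : 1 <= p).
Implicit Types (f g : dual E -> R) (A : set (dual E -> R)).

Let p_gt0 : 0 < p. Proof. exact: lt_le_trans p1. Qed.
Let p_ge0 : 0 <= p. Proof. exact: ltW. Qed.

Lemma H_linear_subspace : linear_subspace (H_space E).
Proof.
split=> [l xs l0|c f g Hf Hg l xs l0]; first by rewrite mulr0.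
by rewrite Hf// Hg// mulrDr mulrCA.
Qed.

Lemma H_abs f : H_space E f -> H_space E (fun xs => `|f xs|).
Proof. by move=> Hf l xs l0; rewrite Hf// normrM ger0_norm. Qed.

Lemma H_max f g : H_space E f -> H_space E g ->
  H_space E (fun xs => Num.max (f xs) (g xs)).
Proof. by move=> Hf Hg l xs l0; rewrite Hf// Hg// maxr_pMr. Qed.

Lemma H_min f g : H_space E f -> H_space E g ->
  H_space E (fun xs => Num.min (f xs) (g xs)).
Proof. by move=> Hf Hg l xs l0; rewrite Hf// Hg// minr_pMr. Qed.

Lemma H_at0 f : H_space E f -> f 0 = 0.
Proof. by move=> Hf; rewrite -(scale0r 0) Hf// mul0r. Qed.

Lemma H_delta (x : E) : H_space E (delta x).
Proof. by []. Qed.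

Lemma ideal_is_sublattice A : order_ideal_of (H_space E) A ->
  sublattice_of (H_space E) A.
Proof.
move=> [AH lA sA]; split=> // f g Af Ag.
have Aabs h : A h -> A (fun xs => `|h xs|).
  by move=> Ah; apply: (sA _ h) => //; [exact/H_abs/AH|move=> t; rewrite normr_id].
have AD := linear_subspaceD lA (Aabs _ Af) (Aabs _ Ag).
split; apply: (sA _ _ _ AD).
- by apply: H_max; exact: AH.
- move=> t; rewrite (@ger0_norm _ (_ + _)) ?addr_ge0//.
  by case: (leP (f t) (g t)) => _; rewrite ?lerDl ?lerDr.
- by apply: H_min; exact: AH.
- move=> t; rewrite (@ger0_norm _ (_ + _)) ?addr_ge0//.
  by case: (leP (f t) (g t)) => _; rewrite ?lerDl ?lerDr.
Qed.

Lemma Hp_ideal : order_ideal_of (H_space E) (Hp_space p E).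
Proof.
split.
- by move=> f [].
- split.
    apply/Hp_spaceP => //; split; first by have [] := H_linear_subspace.
    exists 1 => // n xs _; rewrite big1 ?powR1// => j _.
    by rewrite normr0 powR0// gt_eqF.
  move=> c f g /Hp_spaceP-/(_ p1)[Hf [A A0 fA]] /Hp_spaceP-/(_ p1)[Hg [B B0 gB]].
  apply/Hp_spaceP => //; split; first exact: H_linear_subspace.2.
  have cA0 : 0 <= `|c| * A by rewrite mulr_ge0.
  exists ((`|c| * A + 1) + (B + 1)); first by rewrite !addr_ge0.
  apply: FBL_boundD => //; rewrite ?ltr_wpDl//.
    by apply: (FBL_bound_le p1 _ _ (FBL_boundZ c A0 fA)); rewrite ?lerDl.
  by apply: (FBL_bound_le p1 _ _ gB); rewrite ?lerDl.
- move=> f g Hf /Hp_spaceP-/(_ p1)[Hg [B B0 gB]] fg.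
  by apply/Hp_spaceP => //; split=> //; exists B => //; exact: (FBL_bound_solid p1 fg gB).
Qed.

Lemma deltas_sub_Hp : deltas E `<=` Hp_space p E.
Proof.
move=> _ [x _ <-]; apply/Hp_spaceP => //; split; first exact: H_delta.
by exists `|x| => //; exact: FBL_bound_delta.
Qed.

Lemma ideal_generated_ideal (L S : set (dual E -> R)) :
  order_ideal_of L L -> S `<=` L -> order_ideal_of L (ideal_generated L S).
Proof.
move=> LL SL; split.
- by move=> f; apply.
- by split=> [B [[_ [? _] _] _]//|c f g If Ig B BP];
    have [[_ [_ lB] _] _] := BP; apply: lB; [exact: If|exact: Ig].
- by move=> f g Lf Ig fg B BP; have [[_ _ sB] _] := BP; apply: sB fg => //; exact: Ig.
Qed.

Lemma H_ideal : order_ideal_of (H_space E) (H_space E).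
Proof. by split=> //; exact: H_linear_subspace. Qed.

Lemma I_ideal : order_ideal_of (H_space E) (I_space E).
Proof. by apply: ideal_generated_ideal; [exact: H_ideal|move=> _ [x _ <-]; exact: H_delta]. Qed.

Lemma deltas_sub_I : deltas E `<=` I_space E.
Proof. by move=> f df A [_]; exact. Qed.

Lemma I_sub_Hp : I_space E `<=` Hp_space p E.
Proof. by move=> f; apply; split; [exact: Hp_ideal|exact: deltas_sub_Hp]. Qed.

(** The members of the ideal generated by the evaluations are the functions
    dominated by a finite sum of absolute values of evaluations. *)
Lemma I_spaceP f : I_space E f <->
  H_space E f /\ exists s : seq E, forall xs : dual E, `|f xs| <= \sum_(x <- s) `|xs x|.
Proof.
split.
  pose D := [set f | H_space E f /\
    exists s : seq E, forall xs : dual E, `|f xs| <= \sum_(x <- s) `|xs x|].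
  move=> If; suff /If : order_ideal_of (H_space E) D /\ deltas E `<=` D by [].
  split; last first.
    by move=> _ [x _ <-]; split=> //; exists [:: x] => xs; rewrite big_seq1.
  split; first by move=> ? [].
    split.
      split; first exact: H_linear_subspace.1.
      by exists [::] => xs; rewrite big_nil normr0.
    move=> c g h [Hg [s gs]] [Hh [t ht]]; split; first exact: H_linear_subspace.2.
    exists ([seq c *: x | x <- s] ++ t) => xs; rewrite big_cat/=.
    apply: le_trans (ler_normD _ _) _; apply: lerD; last exact: ht.
    rewrite big_map normrM; apply: le_trans (ler_wpM2l (normr_ge0 _) (gs xs)) _.
    by rewrite mulr_sumr; apply: ler_sum => x _; rewrite dual_atZ normrM.
  move=> g h Hg [Hh [t ht]] gh; split=> //; exists t => xs.
  exact: le_trans (gh xs) (ht xs).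
move=> [Hf [s fs]]; have [_ lI sI] := I_ideal.
have Isum : I_space E (fun xs => \sum_(x <- s) `|xs x|).
  apply: (linear_subspace_sum (F := fun x (xs : dual E) => `|xs x|) s lI) => x.
  apply: (sublattice_abs (ideal_is_sublattice I_ideal)).
  by apply: deltas_sub_I; exists x.
by apply: (sI _ _ Hf Isum) => xs; rewrite (ger0_norm (sumr_ge0 _ _)).
Qed.

Lemma Hp_sublattice : sublattice_of (Hp_space p E) (Hp_space p E).
Proof. by have [_ ? ?] := ideal_is_sublattice Hp_ideal; split. Qed.

Lemma I_sublattice_Hp : sublattice_of (Hp_space p E) (I_space E).
Proof.
by have [_ ? ?] := ideal_is_sublattice I_ideal; split=> //; exact: I_sub_Hp.
Qed.

(** * The closed sublattice generated by the evaluations *)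

Lemma FBL_least A : sublattice_of (Hp_space p E) A -> closed_in_Hp p A ->
  deltas E `<=` A -> FBL p E `<=` A.
Proof. by move=> lA cA dA f; apply. Qed.

Lemma deltas_sub_FBL : deltas E `<=` FBL p E.
Proof. by move=> f df A [_]; exact. Qed.

Lemma Hp_closed : closed_in_Hp p (Hp_space p E).
Proof. by []. Qed.

Lemma FBL_sub_Hp : FBL p E `<=` Hp_space p E.
Proof. by apply: FBL_least; [exact: Hp_sublattice|exact: Hp_closed|exact: deltas_sub_Hp]. Qed.

Lemma FBL_sublattice : sublattice_of (Hp_space p E) (FBL p E).
Proof.
split; first exact: FBL_sub_Hp.
  split=> [A [[[_ [? _] _] _] _]//|c f g Ff Fg A AP].
  by have [[[_ [_ lA] _] _] _] := AP; apply: lA; [exact: Ff|exact: Fg].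
move=> f g Ff Fg; split=> A AP; have [[[_ _ mA] _] _] := AP.
- by have [] := mA f g (Ff _ AP) (Fg _ AP).
- by have [] := mA f g (Ff _ AP) (Fg _ AP).
Qed.

Lemma FBL_closed : closed_in_Hp p (FBL p E).
Proof.
move=> f Hf fA A AP; have [[_ cA] _] := AP; apply: cA => // e e0.
by have [g Fg gP] := fA e e0; exists g => //; exact: Fg.
Qed.

End Ideals.

(** * Weak*-continuity on the dual ball *)

Section WeakStar.
Context {R : realType} {E : normedModType R}.
Implicit Types (f g : dual E -> R).

Lemma eval_weak_star_continuous (x : E) :
  continuous ((fun xs : dual E => xs x) : weak_star_dual E -> R).
Proof.
move=> xs.
have c1 := @initial_continuous (dual E) {ptws E -> R^o} (@dual_fun R E) xs.
have c2 := @proj_continuous E (fun=> R^o) x (dual_fun (xs : dual E)).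
exact: (cvg_comp _ _ c1 c2).
Qed.

(** A map into the dual is weak*-continuous if all its evaluations are
    continuous. *)
Lemma continuous_into_weak_star (T : topologicalType) (F : T -> dual E) :
  (forall x, continuous (fun t => F t x : R)) ->
  continuous (F : T -> weak_star_dual E).
Proof.
move=> cF; apply: continuous_comp_initial => t.
by apply/pointwise_cvgP => x; exact: cF.
Qed.

Lemma Hw_spaceP f : Hw_space E f <-> H_space E f /\
  forall xs : weak_star_dual E, dual_ball (xs : dual E) ->
  forall e, 0 < e -> \forall ys \near within (@dual_ball R E : set (weak_star_dual E)) (nbhs xs),
    `|f xs - f ys| <= e.
Proof.
split=> -[Hf cf]; split=> //.
  move=> xs bxs e e0; move/subspace_continuousP : cf => /(_ xs bxs).
  by move=> /cvgrPdist_le/(_ _ e0).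
apply/subspace_continuousP => xs bxs; apply/cvgrPdist_le => e e0.
exact: cf.
Qed.

Lemma deltas_sub_Hw : deltas E `<=` Hw_space E.
Proof.
move=> _ [x _ <-]; split; first exact: H_delta.
apply: continuous_subspaceT; exact: eval_weak_star_continuous.
Qed.

Lemma Hw_linear_subspace : linear_subspace (Hw_space E).
Proof.
split.
  by split; [exact: H_linear_subspace.1|move=> t; exact: cvg_cst].
move=> c f g [Hf cf] [Hg cg]; split; first exact: H_linear_subspace.2.
move=> t; apply: cvgD; last exact: cg.
by apply: cvgM; [exact: cvg_cst|exact: cf].
Qed.

Lemma Hw_max_min f g : Hw_space E f -> Hw_space E g ->
  Hw_space E (fun xs => Num.max (f xs) (g xs)) /\
  Hw_space E (fun xs => Num.min (f xs) (g xs)).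
Proof.
move=> [Hf cf] [Hg cg]; split.
  split; first exact: H_max.
  by move=> t; apply: continuous_max; [exact: cf|exact: cg].
split; first exact: H_min.
by move=> t; apply: continuous_min; [exact: cf|exact: cg].
Qed.

(** Weak*-continuity passes to uniform limits on the ball. *)
Lemma Hw_uniform_limit f : H_space E f ->
  (forall e, 0 < e -> exists2 g, Hw_space E g &
     forall xs, dual_ball xs -> `|f xs - g xs| <= e) ->
  Hw_space E f.
Proof.
move=> Hf fg; apply/Hw_spaceP; split=> // xs bxs e e0.
have e3 : 0 < e / 3 by rewrite divr_gt0.
have [g /Hw_spaceP[_ cg] fgP] := fg _ e3.
have : \forall ys \near within (@dual_ball R E : set (weak_star_dual E)) (nbhs xs),
   dual_ball (ys : dual E) by exact: withinT.
move: (cg xs bxs _ e3); apply: filterS2 => ys gxy bys.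
have := fgP _ bxs; have := fgP _ bys; move: gxy.
rewrite !ler_norml => /andP[? ?] /andP[? ?] /andP[? ?]; apply/andP; split; lra.
Qed.

Context {p : R} (p1 : 1 <= p).

Lemma sublattice_Hw (A : set (dual E -> R)) :
  sublattice_of (Hp_space p E) A -> sublattice_of (Hp_space p E) (A `&` Hw_space E).
Proof.
by move=> lA; apply: sublatticeI => //; [exact: Hw_linear_subspace|exact: Hw_max_min].
Qed.

Lemma Hpw_closed : closed_in_Hp p (Hpw_space p E).
Proof.
move=> f Hf fA; split=> //; apply: Hw_uniform_limit; first by have [] := Hf.
move=> e e0; have [g [_ Hg] /ltW gP] := fA e e0; exists g => // xs bxs.
have /(FBL_norm_leP p1 _ (ltW e0)) fge := gP.
exact: (FBL_bound_ball p1 (ltW e0) fge bxs).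
Qed.

Lemma FBL_sub_Hw : FBL p E `<=` Hw_space E.
Proof.
suff H : FBL p E `<=` Hpw_space p E by move=> f /H[].
apply: FBL_least => //.
- by apply: sublattice_Hw; exact: Hp_sublattice.
- exact: Hpw_closed.
- by move=> f df; split; [exact: deltas_sub_Hp|exact: deltas_sub_Hw].
Qed.

End WeakStar.

(** * Finite-dimensional spaces *)

(** Compactness as an induction principle: a property of sets that passes to
    subsets and to unions of two sets, and holds locally, holds globally. *)
Lemma compact_induction (T : topologicalType) (K : set T) (Q : set T -> Prop) :
  compact K -> Q set0 -> (forall A B, A `<=` B -> Q B -> Q A) ->
  (forall A B, Q A -> Q B -> Q (A `|` B)) ->
  (forall t, K t -> exists2 U, nbhs t U & Q (K `&` U)) -> Q K.
Proof.
move=> cK Q0 Qsub QU Qloc; apply: contrapT => nQ.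
pose F := [set A | Q (K `\` A)].
have FF : ProperFilter F.
  split; first by rewrite /F/= setD0.
  split.
  - by rewrite /F/= setDT.
  - by move=> A B QA QB; rewrite /F/= setDIr; exact: QU.
  - by move=> A B AB; apply: Qsub; exact: setDS.
have FK : F K by rewrite /F/= setDv.
have [t [Kt cl]] := cK F FF FK.
have [U Ut QKU] := Qloc t Kt.
have FU : F (~` U) by rewrite /F/= setDE setCK.
by have [y []] := cl _ _ FU Ut.
Qed.

Lemma continuous_sum (R : realType) (T : topologicalType) (I : Type) (r : seq I)
    (F : I -> T -> R) :
  (forall i, continuous (F i)) -> continuous (fun t => \sum_(i <- r) F i t).
Proof.
move=> cF; elim: r => [|i r IH].
  rewrite (_ : (fun _ => _) = fun=> 0); first by move=> t; exact: cvg_cst.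
  by apply/funext => t; rewrite big_nil.
rewrite (_ : (fun _ => _) = fun t => F i t + \sum_(j <- r) F j t).
  by move=> t; apply: cvgD; [exact: cF|exact: IH].
by apply/funext => t; rewrite big_cons.
Qed.

Section FiniteDimensional.
Context {R : realType} {E : normedModType R} {n : nat}.
Variables (x : 'I_n -> E) (f : 'I_n -> dual E).
Hypothesis fx : forall i j, f i (x j) = (i == j)%:R.
Hypothesis span : forall z, z = \sum_(i < n) f i z *: x i.

(** The l^1-norm of the coordinates, as a function on the dual. *)
Let u (xs : dual E) : R := \sum_(i < n) `|xs (x i)|.

Let u_ge0 xs : 0 <= u xs. Proof. by apply: sumr_ge0. Qed.

(** A multiple of [u] dominates the dual norm. *)
Lemma coordinate_bound : exists2 C, 0 < C &
  forall (xs : dual E) z, `|z| <= 1 -> `|xs z| <= C * u xs.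
Proof.
have /choice[c cP] : forall i, exists c, 0 <= c /\ forall z, `|f i z| <= c * `|z|.
  by move=> i; have [c c0 cP] := dual_boundP (f i); exists c.
pose C := 1 + \sum_(i < n) c i.
have s0 : 0 <= \sum_(i < n) c i by apply: sumr_ge0 => i _; case: (cP i).
exists C; first by rewrite ltr_pwDl.
move=> xs z z1; rewrite [z in xs z]span dual_at_sum.
apply: le_trans (ler_norm_sum _ _ _) _; rewrite mulr_sumr.
apply: ler_sum => i _; rewrite normrM; apply: ler_wpM2r => //.
have [ci0 ciP] := cP i; apply: le_trans (ciP z) _.
apply: (@le_trans _ _ (c i)); first by rewrite -[leRHS]mulr1 ler_wpM2l.
rewrite /C (bigD1 i)//= addrCA lerDl addr_ge0//.
by apply: sumr_ge0 => j _; case: (cP j).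
Qed.

Lemma u_eq0 xs : u xs = 0 -> xs = 0.
Proof.
move=> u0; apply: dual_ext => z; rewrite [z]span dual_at_sum dual_at_sum.
apply: eq_bigr => i _; congr (_ * _).
move/eqP: u0; rewrite psumr_eq0// => /allP/(_ i (mem_index_enum _)).
by rewrite /= normr_eq0 => /eqP.
Qed.

Lemma u_I : I_space E u.
Proof.
apply/I_spaceP; split.
  move=> l xs l0; rewrite /u mulr_sumr; apply: eq_bigr => i _.
  by rewrite dualZE normrM ger0_norm.
exists (map x (enum 'I_n)) => xs; rewrite ger0_norm//.
by rewrite big_map big_enum.
Qed.

Lemma H_dominated_I F M : H_space E F -> (forall xs, `|F xs| <= M * u xs) ->
  I_space E F.
Proof.
move=> HF FM; have [_ lI sI] := @I_ideal R E.
apply: (sI _ _ HF (linear_subspaceZ M lI u_I)) => xs.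
exact: le_trans (FM xs) (ler_norm _).
Qed.

Lemma bounded_on_ball_I F M : H_space E F ->
  (forall xs, dual_ball xs -> `|F xs| <= M) -> I_space E F.
Proof.
move=> HF FM; have [C C0 CP] := coordinate_bound.
apply: (@H_dominated_I _ (C * M)) => // xs.
have [u0|u0] := eqVneq (u xs) 0.
  by rewrite (u_eq0 u0) H_at0// normr0 -(u_eq0 u0) u0 mulr0.
have up : 0 < C * u xs by rewrite mulr_gt0// lt0r u0/=.
have xsE : xs = (C * u xs) *: ((C * u xs)^-1 *: xs).
  by rewrite scalerA divff ?scale1r// gt_eqF.
rewrite {1}xsE HF ?(ltW up)// normrM gtr0_norm// (mulrAC C M).
apply: ler_wpM2l; first exact: ltW.
apply: FM; apply/dual_ballP => z z1.
by rewrite dualZE normrM gtr0_norm ?invr_gt0// ler_pdivrMl// mulr1; exact: CP.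
Qed.

Context {p : R} (p1 : 1 <= p).

Lemma finite_dimensional_Hp_sub_I : Hp_space p E `<=` I_space E.
Proof.
move=> F /Hp_spaceP-/(_ p1)[HF [M M0 FM]].
by apply: (bounded_on_ball_I (M := M)) => // xs; exact: FBL_bound_ball FM.
Qed.

Lemma u_FBL : FBL p E u.
Proof.
have lF := @FBL_sublattice _ p E p1; have [_ lin _] := lF.
apply: (linear_subspace_sum (F := fun i (xs : dual E) => `|xs (x i)|) _ lin) => i.
by apply: (sublattice_abs lF); apply: deltas_sub_FBL; exists (x i).
Qed.

(** The l^1-sphere of the coordinate space. *)
Let S := [set a : 'rV[R]_n | \sum_(i < n) `|a 0 i| = 1].

Let l1dist (a : 'rV[R]_n) : continuous (fun b : 'rV[R]_n => \sum_(i < n) `|b 0 i - a 0 i|).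
Proof.
apply: (@continuous_sum R _ _ _ (fun i (b : 'rV[R]_n) => `|b 0 i - a 0 i|)) => i b.
have bF := nbhs_filter b; apply: cvg_norm; apply: cvgB; last exact: cvg_cst.
exact: coord_continuous.
Qed.

Let compact_S : compact S.
Proof.
apply: bounded_closed_compact.
  exists 1; split; first exact: num_real.
  move=> M M1 a Sa; apply: le_trans (ltW M1).
  rewrite /Num.Def.normr/= mx_normrE; apply/bigmax_leP; split=> // -[i j] _ /=.
  rewrite (ord1 i) -Sa (bigD1 j)//= lerDl; exact: sumr_ge0.
have l1E (b : 'rV[R]_n) : \sum_(i < n) `|b 0 i - (0 : 'rV[R]_n) 0 i| = \sum_(i < n) `|b 0 i|.
  by apply: eq_bigr => i _; rewrite mxE subr0.
have -> : S = (fun b : 'rV[R]_n => \sum_(i < n) `|b 0 i - (0 : 'rV[R]_n) 0 i|) @^-1` [set 1].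
  by apply/seteqP; split=> b; rewrite /S/= l1E.
by apply: preimage_closed => [b _|]; [exact: l1dist|exact: closed_eq].
Qed.

(** The functionals with coordinates [a], scaled by [c]. *)
Let Phi c (a : 'rV[R]_n) : dual E := \sum_(i < n) (c * a 0 i) *: f i.

Let Phi_at c a i : Phi c a (x i) = c * a 0 i.
Proof.
rewrite dual_sumE (bigD1 i)// dualZE fx eqxx mulr1 big1 => [|j ji].
  by rewrite /= addr0.
by rewrite dualZE fx; move: ji; case: eqP => // _ _; rewrite mulr0.
Qed.

Let u_Phi c a : 0 <= c -> u (Phi c a) = c * \sum_(i < n) `|a 0 i|.
Proof.
by move=> c0; rewrite mulr_sumr; apply: eq_bigr => i _; rewrite Phi_at normrM ger0_norm.
Qed.

Let Phi_continuous c : continuous (Phi c : 'rV[R]_n -> weak_star_dual E).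
Proof.
apply: continuous_into_weak_star => z.
rewrite [X in continuous X](_ : _ = fun a : 'rV[R]_n => \sum_(i < n) c * a 0 i * f i z); last first.
  by apply/funext => a; rewrite dual_sumE.
apply: (@continuous_sum R _ _ _ (fun i (a : 'rV[R]_n) => c * a 0 i * f i z)) => i a.
have aF := nbhs_filter a.
by apply: cvgM; [apply: cvgM; [exact: cvg_cst|exact: coord_continuous]|exact: cvg_cst].
Qed.

(** Every weak*-continuous positively homogeneous [F] is approximated by
    members of the lattice generated by the evaluations. On the image of the
    l^1-sphere such an approximation is a finite minimum of functions
    [F t + K |a - t|], whose homogeneous version uses [u] in place of the
    constant 1. *)
Lemma Hw_sub_FBL : Hw_space E `<=` FBL p E.
Proof.
move=> F FHw; have [HF cF] := (Hw_spaceP F).1 FHw.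
have [C C0 CP] := coordinate_bound.
have Ci0 : 0 <= C^-1 by rewrite invr_ge0 ltW.
pose Psi := Phi C^-1; pose G a := F (Psi a).
have uPsi a : S a -> C * u (Psi a) = 1.
  by move=> Sa; rewrite u_Phi// Sa mulr1 divff// gt_eqF.
have ballPsi a : S a -> dual_ball (Psi a).
  by move=> Sa; apply/dual_ballP => z z1; rewrite -(uPsi a Sa); exact: CP.
have cPsi : continuous (Psi : 'rV[R]_n -> weak_star_dual E) by exact: Phi_continuous.
have cG t : S t -> forall e : R, 0 < e -> exists2 U, nbhs t U &
    forall a, U a -> S a -> `|G t - G a| <= e.
  move=> St e e0; have H := cPsi t _ (cF (Psi t) (ballPsi t St) e e0).
  exists ((Psi : 'rV[R]_n -> weak_star_dual E) @^-1`
      [set ys | dual_ball (ys : dual E) -> `|G t - F ys| <= e]); first exact: H.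
  by move=> a Ua Sa; apply: Ua; exact: ballPsi.
have sphere_rep xs : u xs != 0 -> exists2 a, S a & xs = (C * u xs) *: Psi a.
  move=> u0; pose a := \row_i ((u xs)^-1 * xs (x i)); exists a.
    rewrite /S/= -[RHS](mulVf u0) mulr_sumr; apply: eq_bigr => i _.
    by rewrite mxE normrM ger0_norm ?invr_ge0.
  apply: dual_ext => z; rewrite [z]span !dual_at_sum; apply: eq_bigr => i _.
  rewrite dualZE Phi_at mxE; congr (_ * _).
  by rewrite mulrACA divff ?gt_eqF// mul1r mulrA divff// mul1r.
have [M0 M0P] : exists M, forall a, S a -> `|G a| <= M.
  apply: (compact_induction (Q := fun A => exists M, forall a, A a -> `|G a| <= M)
    compact_S).
  - by exists 0.
  - by move=> A B AB [M MP]; exists M => a /AB; exact: MP.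
  - move=> A B [M MP] [N NP]; exists (Num.max M N) => a [/MP|/NP] H.
      by rewrite le_max H.
    by rewrite le_max H orbT.
  - move=> t St; have [U Ut UP] := cG t St 1 ltr01.
    exists U => //; exists (`|G t| + 1) => a [Sa Ua].
    have := UP a Ua Sa; have := ler_normB (G t) (G t - G a); rewrite subKr; lra.
pose M := Num.max 0 M0.
have MP a : S a -> `|G a| <= M by move=> /M0P H; rewrite le_max H orbT.
have M_ge0 : 0 <= M by rewrite le_max lexx.
have FI : I_space E F.
  apply: (@H_dominated_I _ (M * C)) => // xs.
  have [u0|/sphere_rep[a Sa xsE]] := eqVneq (u xs) 0.
    by rewrite u0 mulr0 (u_eq0 u0) H_at0// normr0.
  rewrite [in leLHS]xsE HF; last by rewrite mulr_ge0// ltW.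
  rewrite normrM ger0_norm; last by rewrite mulr_ge0// ltW.
  by rewrite mulrC -mulrA; apply: ler_wpM2r; [rewrite mulr_ge0// ltW|exact: MP].
have lF := @FBL_sublattice _ p E p1; have [_ lin mm] := lF.
have cuF c : FBL p E (fun xs => c * (C * u xs)).
  exact: (linear_subspaceZ c lin (linear_subspaceZ C lin u_FBL)).
have approx e : 0 < e -> exists g, [/\ FBL p E g,
    forall a, S a -> G a - e <= g (Psi a) &
    forall a, S a -> g (Psi a) <= G a + e].
  move=> e0; apply: (compact_induction (Q := fun A => exists g, [/\ FBL p E g,
    forall a, S a -> G a - e <= g (Psi a) &
    forall a, A a -> g (Psi a) <= G a + e]) compact_S).
  - exists (fun xs => M * (C * u xs)); split=> // a Sa.
    by rewrite uPsi// mulr1; have := MP a Sa; rewrite ler_norml; lra.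
  - by move=> A B AB [g [Fg g1 g2]]; exists g; split=> // a /AB; exact: g2.
  - move=> A B [g [Fg g1 g2]] [h [Fh h1 h2]].
    exists (fun xs => Num.min (g xs) (h xs)); split.
    + by have [] := mm g h Fg Fh.
    + by move=> a Sa; rewrite le_min g1// h1.
    + by move=> a [/g2|/h2] H; rewrite ge_min H ?orbT.
  - move=> t St.
    have e20 : 0 < e / 2 by rewrite divr_gt0.
    have [U Ut UP] := cG t St _ e20.
    pose d (a : 'rV[R]_n) := \sum_(i < n) `|a 0 i - t 0 i|.
    have d_ge0 a : 0 <= d a by exact: sumr_ge0.
    have dt0 : d t = 0 by rewrite /d big1// => i _; rewrite subrr normr0.
    have [r r0 rP] : exists2 r, 0 < r & forall a, d a < r -> U a.
      move/nbhs_ballP : Ut => [r /= r0 rU]; exists r => // a dar; apply: rU.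
      rewrite mx_norm_ball /ball_/= /Num.Def.normr/= mx_normrE.
      apply/bigmax_ltP; split=> // -[i j] _ /=; rewrite (ord1 i) !mxE distrC.
      apply: le_lt_trans dar; rewrite /d (bigD1 j)//= lerDl; exact: sumr_ge0.
    (* Beyond distance [r] from [t], the slope [K] outweighs the oscillation
       [2 M] of [G] on the sphere. *)
    pose K := 2 * M / r; have K0 : 0 <= K by rewrite divr_ge0 ?(ltW r0)// mulr_ge0.
    pose g xs := G t * (C * u xs) + K * \sum_(i < n) `|C * xs (x i) - t 0 i * (C * u xs)|.
    have gPsi a : S a -> g (Psi a) = G t + K * d a.
      move=> Sa; rewrite /g uPsi// mulr1; congr (_ + _ * _).
      by apply: eq_bigr => i _; rewrite Phi_at mulr1 mulVKf// gt_eqF.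
    have Fg : FBL p E g.
      apply: (linear_subspaceD lin (cuF _) (linear_subspaceZ K lin _)).
      apply: (linear_subspace_sum (F := fun i (xs : dual E) =>
        `|C * xs (x i) - t 0 i * (C * u xs)|) _ lin) => i.
      apply: (sublattice_abs lF (linear_subspaceB lin (linear_subspaceZ C lin _) (cuF _))).
      by apply: deltas_sub_FBL; exists (x i).
    have g1 a : S a -> G a - e <= g (Psi a).
      move=> Sa; rewrite gPsi//; have [dr|rd] := ltP (d a) r.
        have := UP a (rP a dr) Sa; have := mulr_ge0 K0 (d_ge0 a).
        by rewrite ler_norml; lra.
      have : 2 * M <= K * d a.
        have -> : 2 * M = K * r by rewrite divfK// gt_eqF.
        exact: ler_wpM2l.
      by have := MP a Sa; have := MP t St; rewrite !ler_norml; lra.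
    have [V Vt VP] : exists2 V, nbhs t V & forall a, V a -> K * d a <= e / 2.
      have tF := nbhs_filter t.
      have /cvgrPdist_le/(_ _ e20) : (fun a => K * d a) @ t --> K * d t.
        by apply: cvgM; [exact: cvg_cst|exact: l1dist].
      rewrite dt0 mulr0 => H; exists [set a | `|0 - K * d a| <= e / 2]; first exact: H.
      by move=> a /=; rewrite sub0r normrN ger0_norm// mulr_ge0.
    exists (U `&` V); first exact: filterI.
    exists g; split=> // a [Sa [Ua Va]]; rewrite gPsi//.
    by have := UP a Ua Sa; have := VP a Va; rewrite ler_norml; lra.
apply: (closed_in_HpP p1 _).1 (@FBL_closed _ p E) _ _ _.
  exact: (I_sub_Hp p1).
move=> e e0.
have /Hp_spaceP-/(_ p1)[_ [B B0 uB]] := I_sub_Hp p1 u_I.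
have e'0 : 0 < e / (C * (B + 1)) by rewrite divr_gt0// mulr_gt0// ltr_wpDl.
have [g [Fg g1 g2]] := approx _ e'0; exists g => //.
have Hg : H_space E g by have [] := FBL_sub_Hp p1 Fg.
pose k := e / (C * (B + 1)) * C.
have k0 : 0 <= k by rewrite mulr_ge0 ?(ltW e'0) ?(ltW C0).
have kB : `|k| * B <= e.
  have B10 : 0 < B + 1 by rewrite ltr_wpDl.
  have kE : k = e / (B + 1) by rewrite /k; field; rewrite !gt_eqF.
  rewrite ger0_norm// kE mulrAC ler_pdivrMr//; apply: ler_wpM2l; first exact: ltW.
  by rewrite lerDl.
apply: (FBL_bound_le p1 _ kB); first by rewrite mulr_ge0.
apply: (FBL_bound_solid p1 _ (FBL_boundZ k B0 uB)) => xs.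
have [u0|/sphere_rep[a Sa xsE]] := eqVneq (u xs) 0.
  by rewrite u0 mulr0 (u_eq0 u0) !H_at0// subrr normr0.
have cu0 : 0 <= C * u xs by rewrite mulr_ge0// ltW.
rewrite {1 2}xsE HF// Hg// -mulrBr normrM (ger0_norm cu0) (ger0_norm (mulr_ge0 k0 (u_ge0 xs))).
rewrite /k -[leRHS]mulrA [leRHS]mulrC; apply: ler_wpM2l => //.
by have := g1 a Sa; have := g2 a Sa; rewrite /G ler_norml; lra.
Qed.

End FiniteDimensional.

(** * Dyadic sums of positively homogeneous functions *)

Section DyadicSums.
Context {R : realType} {E : normedModType R}.
Implicit Types (f g : dual E -> R) (xs : dual E).

Lemma dual_ball_absorbs xs : exists l : R, exists2 ys, 0 < l & dual_ball ys /\ xs = l *: ys.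
Proof.
have [C C0 CP] := dual_boundP xs; have l0 : 0 < C + 1 by rewrite ltr_wpDl.
exists (C + 1), ((C + 1)^-1 *: xs) => //; split; last first.
  by rewrite scalerA divff ?scale1r// gt_eqF.
apply/dual_ballP => x x1; rewrite dualZE normrM gtr0_norm ?invr_gt0//.
rewrite ler_pdivrMl// mulr1; apply: le_trans (CP x) _.
apply: (@le_trans _ _ C); last by rewrite lerDl.
by rewrite -[leRHS]mulr1; apply: ler_wpM2l.
Qed.

(** The partial sum of the first [N] terms of [sum_k 2^-k h k]. *)
Definition dyadic_sum (h : nat -> dual E -> R) N xs : R :=
  \sum_(k < N) 2^-1 ^+ k * h k xs.

Variable h : nat -> dual E -> R.
Hypothesis hH : forall k, H_space E (h k).
Hypothesis h_ge0 : forall k xs, 0 <= h k xs.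
Hypothesis h_le1 : forall k xs, dual_ball xs -> h k xs <= 1.

Lemma dyadic_gt0 N : 0 < 2^-1 ^+ N :> R.
Proof. by rewrite exprn_gt0// invr_gt0. Qed.

Lemma dyadic_sumS N xs :
  dyadic_sum h N.+1 xs = dyadic_sum h N xs + 2^-1 ^+ N * h N xs.
Proof. by rewrite /dyadic_sum big_ord_recr. Qed.

Lemma dyadic_sum_mem (A : set (dual E -> R)) N : linear_subspace A ->
  (forall k, A (h k)) -> A (dyadic_sum h N).
Proof.
move=> lA Ah.
apply: (linear_subspace_sum (F := fun (k : 'I_N) xs => 2^-1 ^+ k * h k xs) _ lA) => k.
exact: (linear_subspaceZ (2^-1 ^+ k) lA (Ah k)).
Qed.

Lemma dyadic_sum_H N : H_space E (dyadic_sum h N).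
Proof. by apply: dyadic_sum_mem => //; exact: H_linear_subspace. Qed.

Lemma dyadic_sum_le N M xs : (N <= M)%N -> dyadic_sum h N xs <= dyadic_sum h M xs.
Proof.
move=> /subnKC <-; elim: (M - N)%N => [|d IH]; first by rewrite addn0.
rewrite addnS dyadic_sumS; apply: le_trans IH _.
by rewrite lerDl mulr_ge0// ltW// dyadic_gt0.
Qed.

Lemma dyadic_sum_tail N M xs : dual_ball xs ->
  dyadic_sum h M xs <= dyadic_sum h N xs + 2 * 2^-1 ^+ N.
Proof.
move=> bxs; have [MN|/ltnW/subnKC <-] := leqP M N.
  apply: le_trans (dyadic_sum_le xs MN) _.
  by rewrite lerDl mulr_ge0// ltW// dyadic_gt0.
suff H d : dyadic_sum h (N + d) xs <=
    dyadic_sum h N xs + 2 * 2^-1 ^+ N - 2 * 2^-1 ^+ (N + d).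
  by apply: le_trans (H _) _; rewrite gerBl mulr_ge0// ltW// dyadic_gt0.
elim: d => [|d IH]; first by rewrite addn0 addrK.
rewrite addnS dyadic_sumS exprS.
have := dyadic_gt0 (N + d); have := h_le1 (N + d) bxs; set c := _ ^+ (N + d) => hc c0.
have : c * h (N + d)%N xs <= c by rewrite -[leRHS]mulr1 ler_pM2l.
by move: IH; rewrite -/c; lra.
Qed.

(** The limit is obtained as the supremum of the increasing partial sums. *)
Lemma dyadic_sum_limit : exists f, [/\ H_space E f,
  forall N xs, dyadic_sum h N xs <= f xs &
  forall N xs, dual_ball xs -> f xs <= dyadic_sum h N xs + 2 * 2^-1 ^+ N].
Proof.
pose A xs := [set dyadic_sum h N xs | N in setT].
have AS xs : has_sup (A xs).
  split; first by exists (dyadic_sum h 0 xs), 0%N.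
  have [l [ys l0 [bys ->]]] := dual_ball_absorbs xs.
  exists (l * 2) => _ [N _ <-]; rewrite dyadic_sum_H ?(ltW l0)// ler_pM2l//.
  by have := dyadic_sum_tail 0 N bys; rewrite [dyadic_sum _ 0 _]big_ord0 add0r expr0 mulr1.
have le_f N xs : dyadic_sum h N xs <= sup (A xs).
  by apply: sup_upper_bound => //; exists N.
have f_le xs r : (forall N, dyadic_sum h N xs <= r) -> sup (A xs) <= r.
  by move=> H; apply: ge_sup => [|_ [N _ <-]]; [exact: (AS xs).1|exact: H].
exists (fun xs => sup (A xs)); split=> // [l xs|N xs bxs]; last first.
  by apply: f_le => M; exact: dyadic_sum_tail.
rewrite le_eqVlt => /predU1P[<-|l0].
  rewrite scale0r mul0r; apply/eqP; rewrite eq_le; apply/andP; split.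
    by apply: f_le => N; rewrite (H_at0 (dyadic_sum_H N)).
  by apply: le_trans (le_f 0%N 0); rewrite (H_at0 (dyadic_sum_H 0)).
apply/eqP; rewrite eq_le; apply/andP; split.
  by apply: f_le => N; rewrite dyadic_sum_H ?(ltW l0)// ler_pM2l.
rewrite mulrC -ler_pdivlMr//; apply: f_le => N; rewrite ler_pdivlMr// mulrC.
by rewrite -dyadic_sum_H ?(ltW l0).
Qed.

Lemma dyadic_small (e : R) : 0 < e -> exists N, 2^-1 ^+ N < e.
Proof.
move=> e0; exists (Num.bound e^-1).
have := upper_nthrootP (leqnn (Num.bound e^-1)).
by rewrite exprVn -[X in _ < X -> _]invrK ltf_pV2// posrE ?invr_gt0 ?exprn_gt0// invr_gt0 exprn_gt0.
Qed.

Lemma dyadic_sum_limit_Hw f : (forall k, Hw_space E (h k)) -> H_space E f ->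
  (forall N xs, dyadic_sum h N xs <= f xs) ->
  (forall N xs, dual_ball xs -> f xs <= dyadic_sum h N xs + 2 * 2^-1 ^+ N) ->
  Hw_space E f.
Proof.
move=> hHw Hf fge fle; apply: Hw_uniform_limit => // e e0.
have [|N NP] := @dyadic_small (e / 2); first by rewrite divr_gt0.
exists (dyadic_sum h N); first exact: (dyadic_sum_mem _ Hw_linear_subspace).
move=> xs bxs; have := fge N xs; have := fle N xs bxs => ? ?.
by rewrite ger0_norm ?subr_ge0//; lra.
Qed.

Context {p : R} (p1 : 1 <= p).

Lemma weakly_contractive_ball n (xs : 'I_n -> dual E) j :
  weakly_contractive (p := p) xs -> dual_ball (xs j).
Proof.
move=> xs1; apply/dual_ballP => x /xs1 H.
have {}H : `|xs j x| `^ p <= 1 `^ p.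
  rewrite powR1; apply: le_trans H; rewrite (bigD1 j)//= lerDl.
  by apply: sumr_ge0 => i _; exact: powR_ge0.
rewrite leNgt; apply/negP => H1.
have := @gt0_ltr_powR R p (lt_le_trans ltr01 p1) 1 `|xs j x|.
by rewrite !nnegrE => /(_ ler01 (normr_ge0 _) H1); rewrite ltNge H.
Qed.

(** On a given weakly contractive family the tail is split, by Minkowski, into
    a finite block of norm at most [3 2^-N] and a remainder whose contribution
    is made at most [2^-N] by going far enough along the series. *)
Lemma FBL_bound_dyadic_tail f : (forall k, FBL_bound (p := p) (h k) 1) ->
  (forall N xs, dyadic_sum h N xs <= f xs) ->
  (forall N xs, dual_ball xs -> f xs <= dyadic_sum h N xs + 2 * 2^-1 ^+ N) ->
  forall N, FBL_bound (p := p) (fun xs => f xs - dyadic_sum h N xs) (4 * 2^-1 ^+ N).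
Proof.
move=> hB fge fle N.
have p0 : 0 < p by apply: lt_le_trans p1.
(* The strictly positive constant [3 2^-N - 2 2^-(N + d)], rather than
   [2 2^-N - 2 2^-(N + d)], keeps [FBL_boundD] applicable from [d = 0] on. *)
have sB d : FBL_bound (p := p) (fun xs => dyadic_sum h (N + d) xs - dyadic_sum h N xs)
    (3 * 2^-1 ^+ N - 2 * 2^-1 ^+ (N + d)).
  elim: d => [|d IH].
    move=> n xs _; rewrite big1 ?powR_ge0// => j _.
    by rewrite addn0 subrr normr0 powR0// gt_eqF.
  have -> : 3 * 2^-1 ^+ N - 2 * 2^-1 ^+ (N + d.+1) =
     3 * 2^-1 ^+ N - 2 * 2^-1 ^+ (N + d) + `|2^-1 ^+ (N + d)| * 1 :> R.
    by rewrite addnS exprS gtr0_norm ?dyadic_gt0//; field.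
  rewrite (_ : (fun xs => _) = fun xs => (dyadic_sum h (N + d) xs - dyadic_sum h N xs) +
     2^-1 ^+ (N + d) * h (N + d)%N xs); last first.
    by apply/funext => xs; rewrite addnS dyadic_sumS addrAC.
  apply: FBL_boundD => //.
  - rewrite exprD; have := dyadic_gt0 N; set c := _ ^+ N => c0.
    have d1 : 2^-1 ^+ d <= 1 :> R by rewrite exprn_ile1// invf_le1// ler1n.
    have : c * 2^-1 ^+ d <= c * 1 by rewrite ler_pM2l.
    by lra.
  - by have g0 := dyadic_gt0 (N + d); rewrite mulr1 gtr0_norm.
  - by apply: FBL_boundZ => //; exact: hB.
move=> n xs xs1.
have [|M MP] := @dyadic_small (2^-1 ^+ N / (2 * n.+1%:R)).
  by rewrite divr_gt0 ?dyadic_gt0// mulr_gt0.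
have -> : 4 * 2^-1 ^+ N = 3 * 2^-1 ^+ N + 2^-1 ^+ N :> R by ring.
have dE ys : f ys - dyadic_sum h N ys = (dyadic_sum h (N + M) ys - dyadic_sum h N ys) +
    (f ys - dyadic_sum h (N + M) ys) by ring.
under eq_bigr => j _ do rewrite dE.
have gN := dyadic_gt0 N; have gM := dyadic_gt0 M.
have gNM : 2^-1 ^+ (N + M) <= 2^-1 ^+ M :> R.
  rewrite exprD -[leRHS]mul1r ler_pM2r//.
  by rewrite exprn_ile1// invf_le1// ler1n.
have gNM0 := dyadic_gt0 (N + M).
apply: sum_powR_minkowski => //.
  apply: le_trans (sB M n xs xs1) _.
  have NM_N : 2^-1 ^+ (N + M) <= 2^-1 ^+ N :> R.
    rewrite exprD -[leRHS]mulr1 ler_pM2l//.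
    by rewrite exprn_ile1// invf_le1// ler1n.
  by apply: ge0_ler_powR; rewrite ?nnegrE ?(ltW p0)//; lra.
pose t : R := 2 * 2^-1 ^+ M; have t0 : 0 <= t by rewrite mulr_ge0// ltW.
apply: (@le_trans _ _ (\sum_(j < n) t `^ p)).
  apply: ler_sum => j _; apply: ge0_ler_powR; rewrite ?nnegrE ?(ltW p0)//.
  rewrite ger0_norm ?subr_ge0//.
  have := fle (N + M)%N _ (weakly_contractive_ball j xs1); rewrite /t; lra.
rewrite sumr_const card_ord -(mulr_natl (t `^ p)).
apply: (@le_trans _ _ ((n.+1%:R * t) `^ p)).
  rewrite (powRM p (ler0n R n.+1) t0); apply: ler_wpM2r; first exact: powR_ge0.
  by apply: le_trans (le1r_powR _ p1); rewrite ?ler_nat// ler1n.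
apply: ge0_ler_powR; rewrite ?nnegrE ?(ltW p0) ?mulr_ge0 ?(ltW gN)//.
have n2 : 0 < 2 * n.+1%:R :> R by rewrite mulr_gt0.
have -> : n.+1%:R * t = 2^-1 ^+ M * (2 * n.+1%:R) by rewrite /t; ring.
by rewrite ltW// -ltr_pdivlMr.
Qed.

Lemma dyadic_sum_limit_FBL f : (forall k, FBL p E (h k)) ->
  (forall k, FBL_bound (p := p) (h k) 1) -> H_space E f ->
  (forall N xs, dyadic_sum h N xs <= f xs) ->
  (forall N xs, dual_ball xs -> f xs <= dyadic_sum h N xs + 2 * 2^-1 ^+ N) ->
  FBL p E f.
Proof.
move=> hF hB Hf fge fle; have tail := FBL_bound_dyadic_tail hB fge fle.
apply: (closed_in_HpP p1 _).1 (@FBL_closed _ p E) _ _ _.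
  apply/Hp_spaceP => //; split=> //; exists 4 => //.
  have := tail 0%N; rewrite expr0 mulr1 (_ : (fun xs => _) = f)//.
  by apply/funext => xs; rewrite [dyadic_sum _ 0 _]big_ord0 subr0.
move=> e e0; have [|N NP] := @dyadic_small (e / 4); first by rewrite divr_gt0.
exists (dyadic_sum h N).
  by apply: dyadic_sum_mem => //; have [] := @FBL_sublattice _ p E p1.
have gN := dyadic_gt0 N.
by apply: (FBL_bound_le p1 _ _ (tail N)); rewrite ?mulr_ge0 ?(ltW gN)//; lra.
Qed.

End DyadicSums.

(** * The ideal generated by the evaluations in infinite dimension *)

(** The witness is [sum_k 2^-k |delta (x k)|]. *)
Lemma infinite_dimensional_FBL_nsub_I (R : realType) (E : normedModType R) (p : R)
    (x : nat -> E) (f : nat -> dual E) : 1 <= p ->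
  (forall i, `|x i| <= 1) -> (forall i j, f i (x j) = (i == j)%:R) ->
  ~ (FBL p E `<=` I_space E).
Proof.
move=> p1 x1 fx FI.
pose h k (xs : dual E) : R := `|xs (x k)|.
have hH k : H_space E (h k) by apply: H_abs; exact: H_delta.
have h0 k xs : 0 <= h k xs by exact: normr_ge0.
have h1 k xs : dual_ball xs -> h k xs <= 1 by move=> /dual_ballP; apply.
have hF k : FBL p E (h k).
  by apply: (sublattice_abs (FBL_sublattice p1)); apply: deltas_sub_FBL; exists (x k).
have hB k : FBL_bound (p := p) (h k) 1.
  apply: (FBL_bound_solid p1 (g := delta (x k))).
    by move=> xs; rewrite normr_id.
  exact: (FBL_bound_le p1 _ (x1 k) (FBL_bound_delta p1 (x k))).
have [F [HF Fge Fle]] := dyadic_sum_limit hH h0 h1.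
have /FI/I_spaceP[_ [s Fs]] := dyadic_sum_limit_FBL p1 hF hB HF Fge Fle.
pose y (l : 'I_(size s)) := nth 0 s l.
have [a [[i ai] ay]] := annihilating_combination y (fun k : 'I_(size s).+1 => f k).
set psi := \sum_(k < _) _ in ay.
have psix : psi (x i) = a i.
  rewrite /psi dual_sumE (bigD1 i)// dualZE fx eqxx mulr1 big1 => [|j ji].
    by rewrite /= addr0.
  rewrite dualZE fx; case: eqP => [/val_inj ij|]; last by rewrite mulr0.
  by rewrite ij eqxx in ji.
have : F psi <= 0.
  apply: le_trans (ler_norm _) _; apply: le_trans (Fs psi) _.
  rewrite (big_nth 0) big_mkord big1// => l _.
  by have := ay l; rewrite /y => ->; rewrite normr0.
apply/negP; rewrite -ltNge; apply: lt_le_trans (Fge i.+1 psi).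
rewrite dyadic_sumS ltr_wpDl//.
  by apply: sumr_ge0 => k _; rewrite mulr_ge0// ltW// dyadic_gt0.
by rewrite mulr_gt0 ?dyadic_gt0// /h psix normr_gt0.
Qed.

(** * Families violating summability: the Dvoretzky-Rogers theorem *)

(** Both sides are determinants of products, in the two orders, of the same two
    block matrices. *)
Lemma det_rank_one (R : comNzRingType) n (a : 'cV[R]_n) (b : 'rV[R]_n) :
  \det (1%:M + a *m b) = 1 + (b *m a) 0 0.
Proof.
pose X : 'M[R]_(n + 1) := block_mx 1%:M a (- b) 1%:M.
pose L : 'M[R]_(n + 1) := block_mx 1%:M 0 b 1%:M.
have detL : \det L = 1 by rewrite det_lblock !det1 mulr1.
have LX : L *m X = block_mx 1%:M a 0 (b *m a + 1%:M).
  by rewrite mulmx_block !mulmx1 !mul1mx !mul0mx !addr0 subrr.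
have XL : X *m L = block_mx (1%:M + a *m b) a 0 1%:M.
  by rewrite mulmx_block !mulmx1 !mul1mx !mulmx0 !add0r addNr.
have : \det (X *m L) = \det (L *m X) by rewrite !det_mulmx mulrC.
rewrite XL LX !det_ublock !det1 mulr1 mul1r => ->.
by rewrite det_mx11 !mxE eqxx mulr1n addrC.
Qed.

Lemma bernoulli_ineq (R : realDomainType) (t : R) n : 0 <= t -> t <= 1 ->
  1 - n%:R * t <= (1 - t) ^+ n.
Proof.
move=> t0 t1; elim: n => [|n IH]; first by rewrite mul0r subr0 expr0.
rewrite exprS; apply: (@le_trans _ _ ((1 - t) * (1 - n%:R * t))); last first.
  by apply: ler_wpM2l => //; rewrite subr_ge0.
have : 0 <= n%:R * t * t by rewrite !mulr_ge0.
rewrite -natr1; lra.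
Qed.

Section OptimalDesign.
Context {R : realType} {E : normedModType R} {n : nat}.
Variables (x : 'I_n -> E) (f : 'I_n -> dual E).
Hypothesis n_gt0 : (0 < n)%N.
Hypothesis x1 : forall i, `|x i| <= 1.
Hypothesis fx : forall i j, f i (x j) = (i == j)%:R.

Let v (z : E) : 'cV[R]_n := \col_i f i z.

Let gram m (l : 'I_m -> R) (z : 'I_m -> E) : 'M[R]_n :=
  \sum_(k < m) l k *: (v (z k) *m (v (z k))^T).

(** The second-moment matrices of the finitely supported probabilities on the
    unit ball, in the coordinates [f]. *)
Let design M := exists m (l : 'I_m -> R) (z : 'I_m -> E),
  [/\ forall k, 0 <= l k, \sum_(k < m) l k = 1, forall k, `|z k| <= 1 & M = gram l z].

(** Moving mass [t] to the point [z]. *)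
Let design_update M z t : design M -> `|z| <= 1 -> 0 <= t -> t <= 1 ->
  design ((1 - t) *: M + t *: (v z *m (v z)^T)).
Proof.
move=> [m [l [y [l0 l1 y1 ->]]]] z1 t0 t1.
have wl (k : 'I_m) : widen_ord (leqnSn m) k = lift ord_max k.
  by apply/val_inj; rewrite /= /bump leqNgt ltn_ord.
exists m.+1, (fun k => if unlift ord_max k is Some j then (1 - t) * l j else t),
  (fun k => if unlift ord_max k is Some j then y j else z); split.
- by move=> k; case: unliftP => [j _|_] //; rewrite mulr_ge0// subr_ge0.
- rewrite big_ord_recr/= unlift_none.
  under eq_bigr => k _ do rewrite wl liftK.
  by rewrite -mulr_sumr l1 mulr1 subrK.
- by move=> k; case: unliftP.
- rewrite /gram big_ord_recr/= unlift_none; congr (_ + _).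
  rewrite scaler_sumr; apply: eq_bigr => k _.
  by rewrite wl liftK scalerA.
Qed.

Let design_bounded : exists D, forall M, design M -> \det M <= D.
Proof.
have /choice[c cP] : forall i, exists c, 0 <= c /\ forall z, `|f i z| <= c * `|z|.
  by move=> i; have [c c0 cP] := dual_boundP (f i); exists c.
pose B := \sum_i c i; have B0 : 0 <= B by apply: sumr_ge0 => i _; case: (cP i).
have fB i z : `|z| <= 1 -> `|f i z| <= B.
  move=> z1; have [ci0 ciP] := cP i; apply: le_trans (ciP z) _.
  apply: (@le_trans _ _ (c i)); first by rewrite -[leRHS]mulr1 ler_wpM2l.
  by rewrite /B (bigD1 i)//= lerDl; apply: sumr_ge0 => j _; case: (cP j).
exists (\sum_(s : {perm 'I_n}) \prod_(i < n) (B * B)) => M [m [l [z [l0 l1 z1 ->]]]].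
apply: le_trans (ler_norm _) _; apply: le_trans (ler_norm_sum _ _ _) _.
apply: ler_sum => s _; rewrite normrM normrX normrN1 expr1n mul1r normr_prod.
apply: ler_prod => i _; rewrite normr_ge0/= summxE.
apply: le_trans (ler_norm_sum _ _ _) _.
rewrite -[leRHS]mul1r -l1 mulr_suml; apply: ler_sum => k _.
rewrite !mxE big_ord1 !mxE normrM ger0_norm//; apply: ler_wpM2l => //.
by rewrite normrM; apply: ler_pM => //; apply: fB.
Qed.

(** The uniform probability on the biorthogonal vectors. *)
Let design_positive : exists2 M, design M & 0 < \det M.
Proof.
have n0 : 0 < n%:R :> R by rewrite ltr0n.
exists (gram (fun=> n%:R^-1) x).
  exists n, (fun=> n%:R^-1), x; split=> //.
  by rewrite sumr_const card_ord -[LHS]mulr_natl divff// gt_eqF.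
rewrite (_ : gram _ _ = (n%:R^-1)%:M) ?det_scalar ?exprn_gt0 ?invr_gt0//.
apply/matrixP => i j; rewrite summxE mxE (bigD1 i)//= big1 => [|k ki].
  by rewrite !mxE big_ord1 !mxE !fx eqxx mul1r addr0 eq_sym; case: eqP => _; rewrite ?mulr1 ?mulr0.
by rewrite !mxE big_ord1 !mxE !fx [i == k]eq_sym (negbTE ki) mul0r mulr0.
Qed.

Let quad (A : 'M[R]_n) (a b : 'cV[R]_n) : R := (a^T *m A *m b) 0 0.

(** A design whose determinant exceeds 2/3 of the supremum; the quadratic form
    of the inverse matrix is then bounded on the unit ball. *)
Let optimal_design : exists m (l : 'I_m -> R) (z : 'I_m -> E),
  [/\ forall k, 0 <= l k, \sum_(k < m) l k = 1, forall k, `|z k| <= 1,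
      gram l z \in unitmx &
      forall y, `|y| <= 1 -> quad (invmx (gram l z)) (v y) (v y) <= 4 * n%:R].
Proof.
have n0 : 0 < n%:R :> R by rewrite ltr0n.
have [D0 D0P] := design_bounded; have [M0 dM0 M0gt0] := design_positive.
pose A := [set \det M | M in design].
have supA : has_sup A.
  by split; [exists (\det M0), M0|exists D0 => _ [M dM <-]; exact: D0P].
have D_ge M : design M -> \det M <= sup A.
  by move=> dM; apply: sup_upper_bound => //; exists M.
have Dgt0 : 0 < sup A by apply: lt_le_trans M0gt0 (D_ge _ dM0).
have [|_ [M dM <-] MD] := @sup_adherent _ A (sup A / 3) _ supA.
  by rewrite divr_gt0.
have detM0 : 0 < \det M by apply: lt_trans MD; lra.
have [m [l [z [l0 l1 z1 ME]]]] := dM.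
have Mu : M \in unitmx by rewrite unitmxE unitfE gt_eqF.
exists m, l, z; rewrite -ME; split=> // y y1; rewrite leNgt; apply/negP => qy.
(* Moving mass [1 / (4 n)] to a point where the form exceeds [4 n] multiplies
   the determinant by more than [3/4 * 2], whereas it exceeds 2/3 of the
   supremum. *)
pose t : R := (4 * n%:R)^-1.
have t0 : 0 < t by rewrite invr_gt0 mulr_gt0.
have nt : n%:R * t = 4^-1 by rewrite /t; field; rewrite gt_eqF.
have t1 : t <= 4^-1.
  by rewrite -nt -[leLHS]mul1r ler_pM2r// ler1n.
have tq : 1 < t * quad (invmx M) (v y) (v y).
  by rewrite mulrC -ltr_pdivrMr// div1r /t invrK.
set q := quad _ _ _ in qy tq.
have t_lt1 : t < 1 by apply: le_lt_trans t1 _; rewrite invf_lt1// ltr1n.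
have s0 : 0 < 1 - t by rewrite subr_gt0.
pose s := t / (1 - t).
have ts : t <= s.
  by rewrite /s ler_pdivlMr// -[leRHS]mulr1 ler_pM2l// gerBl ltW.
have q0 : 0 < q by apply: lt_trans qy; rewrite mulr_gt0.
have sq : 1 < s * q by apply: lt_le_trans tq _; rewrite ler_pM2r.
have := D_ge _ (design_update dM y1 (ltW t0) (ltW t_lt1)).
have -> : (1 - t) *: M + t *: (v y *m (v y)^T) =
    (1 - t) *: (M *m (1%:M + (invmx M *m (s *: v y)) *m (v y)^T)).
  rewrite mulmxDr mulmx1 !mulmxA mulmxV// mul1mx scalerDr -scalemxAl scalerA.
  by rewrite /s mulrC divfK ?gt_eqF.
rewrite detZ det_mulmx det_rank_one -scalemxAr -scalemxAr mxE mulmxA.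
rewrite -/(quad (invmx M) (v y) (v y)) -/q.
have H1 : 3 / 4 <= (1 - t) ^+ n.
  apply: le_trans (bernoulli_ineq n (ltW t0) (ltW t_lt1)); rewrite nt; lra.
have H2 : \det M * 2 <= \det M * (1 + s * q) by rewrite ler_pM2l//; lra.
have : 3 / 4 * (\det M * 2) <= (1 - t) ^+ n * (\det M * (1 + s * q)).
  by apply: ler_pM => //; rewrite mulr_ge0// ltW.
lra.
Qed.

Lemma mx_form_sum m (l : 'I_m -> R) (z : 'I_m -> E) (a b : 'cV[R]_n) :
  (a^T *m gram l z *m b) 0 0 =
  \sum_(k < m) l k * ((a^T *m v (z k)) 0 0 * ((v (z k))^T *m b) 0 0).
Proof.
rewrite mulmx_sumr mulmx_suml summxE; apply: eq_bigr => k _.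
rewrite -scalemxAr -scalemxAl mxE; congr (_ * _).
by rewrite mulmxA -(mulmxA (a^T *m v (z k))) [LHS]mxE big_ord1.
Qed.

(** Unit-ball points [z] and functionals [u], weighted by [l], such that [u k]
    is large at [z k] on average, although on the ball the average of the
    [|u k y|] is small. *)
Lemma optimal_design_functionals N : (0 < N)%N -> n = (N ^ 2)%N ->
  exists m (l : 'I_m -> R) (u : 'I_m -> dual E) (z : 'I_m -> E),
  [/\ forall k, 0 <= l k /\ `|z k| <= 1,
      \sum_(k < m) l k = 1,
      forall k, 0 <= u k (z k),
      \sum_(k < m) l k * u k (z k) = n%:R &
      forall y, `|y| <= 1 -> (forall k, `|u k y| <= 4 * n%:R) /\
        \sum_(k < m) l k * `|u k y| <= 2 * N%:R].
Proof.
move=> N0 nN; have [m [l [z [l0 l1 z1 Mu q4]]]] := optimal_design.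
set M := gram l z in Mu q4.
have MT : M^T = M.
  rewrite /M /gram linear_sum/=; apply: eq_bigr => k _.
  by rewrite linearZ/= trmx_mul trmxK.
have MiT : (invmx M)^T = invmx M by rewrite trmx_inv MT.
pose w k := invmx M *m v (z k).
pose u k : dual E := \sum_(i < n) w k i 0 *: f i.
have uE k y : u k y = quad (invmx M) (v (z k)) (v y).
  rewrite dual_sumE /quad -[(v (z k))^T *m _]trmxK trmx_mul trmxK MiT -/(w k).
  by rewrite mxE; apply: eq_bigr => i _; rewrite !mxE.
have qsym a b : quad (invmx M) a b = quad (invmx M) b a.
  by rewrite /quad -[in LHS](trmxK (_ *m b)) mxE !trmx_mul trmxK MiT mulmxA.
(* [M^-1 = M^-1 M M^-1], with [M] expanded as a weighted sum. *)
have qE a : quad (invmx M) a a =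
    \sum_(k < m) l k * quad (invmx M) (v (z k)) a ^+ 2.
  have -> : quad (invmx M) a a = ((invmx M *m a)^T *m M *m (invmx M *m a)) 0 0.
    by rewrite /quad trmx_mul MiT (mulmxKV Mu) mulmxA.
  rewrite mx_form_sum; apply: eq_bigr => k _; congr (_ * _).
  by rewrite trmx_mul MiT mulmxA -/(quad _ _ _) -/(quad _ _ _) qsym.
have q_ge0 a : 0 <= quad (invmx M) a a.
  by rewrite qE; apply: sumr_ge0 => k _; rewrite mulr_ge0// sqr_ge0.
have q_bound a b c : quad (invmx M) a a <= c -> quad (invmx M) b b <= c ->
    `|quad (invmx M) a b| <= c.
  move=> ac bc.
  have quadD e : quad (invmx M) (a + e *: b) (a + e *: b) = quad (invmx M) a a
     + 2 * e * quad (invmx M) a b + e ^+ 2 * quad (invmx M) b b.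
    have -> : 2 * e * quad (invmx M) a b = e * quad (invmx M) a b + e * quad (invmx M) b a.
      by rewrite (qsym b a); ring.
    have trD : (a + e *: b)^T = a^T + e *: b^T by rewrite linearD linearZ.
    rewrite /quad trD !mulmxDl !mulmxDr -!scalemxAl -!scalemxAr scalerA.
    by rewrite !mxE; ring.
  have := q_ge0 (a + 1 *: b); have := q_ge0 (a + (-1) *: b).
  by rewrite !quadD ler_norml => ? ?; apply/andP; split; lra.
exists m, l, u, z; split=> //.
- by move=> k; rewrite uE.
- (* The weighted sum is the trace of [M^-1 M]. *)
  have -> : n%:R = \tr (invmx M *m M) by rewrite mulVmx// mxtrace1.
  rewrite {2}/M /gram mulmx_sumr linear_sum/=; apply: eq_bigr => k _.
  rewrite -scalemxAr linearZ/= uE; congr (_ * _).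
  by rewrite mulmxA mxtrace_mulC mulmxA /quad [RHS]big_ord1.
move=> y y1; split=> [k|]; first by rewrite uE; apply: q_bound; apply: q4.
have N0' : 0 < N%:R :> R by rewrite ltr0n.
(* The quadratic mean of the [u k y] is at most [2 N], as [4 n = (2 N)^2];
   the bound on the mean follows from the arithmetic-geometric inequality. *)
have amgm (b : R) : `|b| <= b ^+ 2 / (4 * N%:R) + N%:R.
  rewrite -real_normK ?num_real//.
  have : 0 <= (`|b| - 2 * N%:R) ^+ 2 / (4 * N%:R).
    by rewrite divr_ge0 ?sqr_ge0// mulr_ge0// ltW.
  have -> : (`|b| - 2 * N%:R) ^+ 2 / (4 * N%:R) = `|b| ^+ 2 / (4 * N%:R) + N%:R - `|b|.
    by field; rewrite gt_eqF.
  by lra.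
apply: (@le_trans _ _ (\sum_(k < m) (l k * u k y ^+ 2 / (4 * N%:R) + l k * N%:R))).
  apply: ler_sum => k _; rewrite -mulrA -mulrDr; exact: ler_wpM2l.
rewrite big_split/= -!mulr_suml l1 mul1r.
under eq_bigr do rewrite uE.
rewrite -qE; have : quad (invmx M) (v y) (v y) / (4 * N%:R) <= N%:R.
  rewrite ler_pdivrMr ?mulr_gt0//; apply: le_trans (q4 y y1) _.
  by rewrite nN natrX; lra.
lra.
Qed.

End OptimalDesign.

Section InfiniteDimensional.
Context {R : realType} {E : normedModType R} {p : R} (p1 : 1 <= p).
Variables (x : nat -> E) (f : nat -> dual E).
Hypothesis x1 : forall i, `|x i| <= 1.
Hypothesis fx : forall i j, f i (x j) = (i == j)%:R.

Let p_gt0 : 0 < p. Proof. exact: lt_le_trans p1. Qed.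
Let p_ge0 : 0 <= p. Proof. exact: ltW. Qed.

(** Finite families in the dual, weakly contractive, have unbounded sums of
    p-th powers of norms. The functionals of [optimal_design_functionals] are
    uniformly bounded by [4 n], so that p-th powers of their values are at most
    [(4 n)^(p - 1)] times the values, and the weights [l k] enter through their
    p-th roots. *)
Lemma dvoretzky_rogers (K : R) : exists m (xs : 'I_m -> dual E) (z : 'I_m -> E),
  [/\ forall k, `|z k| <= 1, weakly_contractive (p := p) xs &
      K <= \sum_(k < m) `|xs k (z k)| `^ p].
Proof.
(* The sum of p-th powers obtained below is at least [8^(1 - p) N / 4]. *)
pose N := (Num.truncn (4 * K * 8 `^ (p - 1))).+1.
have NK : 4 * K * 8 `^ (p - 1) <= N%:R by apply/ltW/truncnS_gt.
have N2_gt0 : (0 < N ^ 2)%N by rewrite expn_gt0.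
have [m [l [u [z [lz l1 uz0 uzn uy]]]]] :=
  optimal_design_functionals (x := fun i : 'I_(N ^ 2) => x i) N2_gt0
    (fun i => x1 i) (fun i j => fx i j) (ltn0Sn _) erefl.
have N0 : 0 < N%:R :> R by rewrite ltr0n.
set n : R := (N ^ 2)%:R in uzn uy.
have n0 : 0 < n by rewrite ltr0n expn_gt0.
have nE : n = N%:R * N%:R by rewrite /n natrX expr2.
have n4 : 0 < 4 * n by rewrite mulr_gt0.
have n2 : 0 < n / 2 by rewrite divr_gt0.
pose A := (4 * n) `^ (p - 1) * (2 * N%:R).
have A0 : 0 < A by rewrite mulr_gt0 ?powR_gt0// mulr_gt0.
have powK (a : R) : 0 <= a -> (a `^ p^-1) `^ p = a.
  by move=> a0; rewrite -powRrM mulVf ?gt_eqF// powRr1.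
pose xs k : dual E := ((A^-1) `^ p^-1 * (l k) `^ p^-1) *: u k.
have xsE k y : `|xs k y| `^ p = A^-1 * (l k * `|u k y| `^ p).
  have [lk _] := lz k.
  have a0 : 0 <= A^-1 `^ p^-1 * l k `^ p^-1 by rewrite mulr_ge0 ?powR_ge0.
  rewrite dualZE normrM powRM// (ger0_norm a0) powRM ?powR_ge0//.
  by rewrite (powK _ lk) powK ?invr_ge0 ?(ltW A0)// mulrA.
exists m, xs, z; split; first by move=> k; case: (lz k).
  move=> y y1; have [u4 lu] := uy y y1.
  under eq_bigr do rewrite xsE.
  rewrite -mulr_sumr mulrC ler_pdivrMr// mul1r.
  apply: (@le_trans _ _ ((4 * n) `^ (p - 1) * \sum_(k < m) l k * `|u k y|)); last first.
    by apply: ler_wpM2l => //; exact: powR_ge0.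
  rewrite mulr_sumr; apply: ler_sum => k _; have [lk _] := lz k.
  rewrite mulrCA; apply: ler_wpM2l => //.
  rewrite -mulr_powRB1// mulrC; apply: ler_wpM2r => //.
  by apply: ge0_ler_powR; rewrite ?nnegrE ?subr_ge0 ?(ltW n4).
under eq_bigr do rewrite xsE.
rewrite -mulr_sumr mulrC ler_pdivlMr//.
(* The values [u k (z k)] have mean [n]; each satisfies
   [a^p >= (n / 2)^(p - 1) (a - n / 2)]. *)
apply: (@le_trans _ _ ((n / 2) `^ (p - 1) * (n / 2))); last first.
  have nS : \sum_(k < m) l k * (u k (z k) - n / 2) = n / 2.
    under eq_bigr do rewrite mulrBr.
    by rewrite sumrB uzn -mulr_suml l1 mul1r; field.
  rewrite -[X in _ * X <= _]nS mulr_sumr; apply: ler_sum => k _; have [lk _] := lz k.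
  rewrite mulrCA; apply: ler_wpM2l => //; have a0 := uz0 k.
  rewrite (ger0_norm a0); have [na|/ltW an] := leP (n / 2) (u k (z k)).
    rewrite -(mulr_powRB1 a0 p_gt0) mulrC; apply: ler_pM.
    - by rewrite subr_ge0.
    - exact: powR_ge0.
    - by rewrite gerBl ltW.
    - by apply: ge0_ler_powR; rewrite ?nnegrE ?subr_ge0 ?(ltW n2).
  apply: le_trans (powR_ge0 _ _).
  by apply: mulr_ge0_le0; rewrite ?powR_ge0// subr_le0.
have -> : A = (n / 2) `^ (p - 1) * (8 `^ (p - 1) * (2 * N%:R)).
  rewrite /A [RHS]mulrA -powRM ?(ltW n2)//; congr (_ `^ _ * _); by field.
rewrite mulrCA; apply: ler_wpM2l; first exact: powR_ge0.
have : 4 * K * 8 `^ (p - 1) * N%:R <= n by rewrite nE ler_pM2r.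
set c := 8 `^ _; have -> : 4 * K * c * N%:R = 2 * (K * (c * (2 * N%:R))) by ring.
lra.
Qed.

Lemma Hw_bigmax (s : seq E) :
  Hw_space E (fun xs : dual E => \big[Num.max/0]_(z <- s) `|xs z|).
Proof.
elim: s => [|z s IH].
  rewrite (_ : (fun _ => _) = fun=> 0); first exact: Hw_linear_subspace.1.
  by apply/funext => xs; rewrite big_nil.
rewrite (_ : (fun _ => _) = fun xs : dual E =>
    Num.max `|xs z| (\big[Num.max/0]_(z <- s) `|xs z|)); last first.
  by apply/funext => xs; rewrite big_cons.
have Hz : Hw_space E (delta z) by apply: deltas_sub_Hw; exists z.
have HzN := linear_subspaceZ (- 1) Hw_linear_subspace Hz.
have [+ _] := Hw_max_min Hz HzN.
rewrite (_ : (fun _ => _) = fun xs : dual E => `|xs z|); last first.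
  by apply/funext => xs; rewrite mulN1r maxrN.
by move=> Haz; have [] := Hw_max_min Haz IH.
Qed.

(** The witness is [sum_k 2^-k max_(z <- s k) |delta z|], where [s k] is a finite
    subset of the unit ball on which some weakly contractive family has values
    with sum of p-th powers at least [2^(k p) k]. *)
Lemma infinite_dimensional_Hw_nsub_Hp : ~ (Hw_space E `<=` Hp_space p E).
Proof.
move=> HwHp.
have /choice[s sP] : forall k : nat, exists s : seq E, (forall z, z \in s -> `|z| <= 1) /\
    exists m (xs : 'I_m -> dual E) (z : 'I_m -> E),
    [/\ forall j, z j \in s, weakly_contractive (p := p) xs &
      (2 ^+ k) `^ p * k%:R <= \sum_(j < m) `|xs j (z j)| `^ p].
  move=> k; have [m [xs [z [z1 xs1 xsK]]]] := dvoretzky_rogers ((2 ^+ k) `^ p * k%:R).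
  exists [seq z j | j : 'I_m]; split; first by move=> _ /mapP[j _ ->].
  by exists m, xs, z; split=> // j; apply: map_f; rewrite mem_enum.
pose h k (xs : dual E) : R := \big[Num.max/0]_(z <- s k) `|xs z|.
have hHw k : Hw_space E (h k) by exact: Hw_bigmax.
have hH k : H_space E (h k) by case: (hHw k).
have h0 k xs : 0 <= h k xs by exact: bigmax_ge_id.
have h1 k xs : dual_ball xs -> h k xs <= 1.
  move=> /dual_ballP xs1; rewrite /h big_seq; apply: bigmax_le => // z zs.
  by apply: xs1; exact: (sP k).1.
have [F [HF Fge Fle]] := dyadic_sum_limit hH h0 h1.
have /HwHp/Hp_spaceP-/(_ p1)[_ [C C0 FC]] := dyadic_sum_limit_Hw hHw HF Fge Fle.
have kC k : k%:R <= C `^ p.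
  have [_ [m [xs [z [zs xs1 xsK]]]]] := sP k.
  apply: le_trans (FC m xs xs1).
  have g0 := @dyadic_gt0 R k.
  apply: (@le_trans _ _ (\sum_(j < m) (2^-1 ^+ k * `|xs j (z j)|) `^ p)).
    under eq_bigr do rewrite powRM ?(ltW g0)//.
    rewrite -mulr_sumr.
    apply: le_trans (ler_wpM2l (powR_ge0 _ _) xsK).
    rewrite mulrA -powRM ?(ltW g0) ?exprn_ge0// -exprMn mulVf// expr1n powR1.
    by rewrite mul1r.
  apply: ler_sum => j _; apply: ge0_ler_powR; rewrite ?nnegrE ?mulr_ge0 ?(ltW g0)//.
  apply: le_trans (ler_norm _); apply: le_trans (Fge k.+1 _).
  rewrite dyadic_sumS; apply: (@le_trans _ _ (2^-1 ^+ k * h k (xs j))).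
    rewrite ler_pM2l//.
    exact: (le_bigmax_seq 0 (z j) xpredT (fun w => `|xs j w|) (zs j) erefl).
  by rewrite lerDr; apply: sumr_ge0 => i _; rewrite mulr_ge0// ltW// dyadic_gt0.
have := kC (Num.truncn (C `^ p)).+1; rewrite leNgt.
by rewrite truncnS_gt.
Qed.

End InfiniteDimensional.

(** * The equivalences *)

Section Equivalences.
Context {R : realType} {E : normedModType R} {p : R} (p1 : 1 <= p).

Lemma finite_dimensional_biorthogonal : finite_dimensional E ->
  exists (n : nat) (x : 'I_n -> E) (f : 'I_n -> dual E),
     (forall i j, f i (x j) = (i == j)%:R) /\
     forall z, z = \sum_(i < n) f i z *: x i.
Proof.
move=> fE; have [//|[x [f [_ fx]]]] := @biorthogonal_dichotomy R E.
by case: (infinite_biorthogonal_infinite_dimensional fx fE).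
Qed.

Lemma finite_dimensional_I_eq_Hp : finite_dimensional E -> I_space E = Hp_space p E.
Proof.
move=> /finite_dimensional_biorthogonal[n [x [f [fx span]]]].
by apply/seteqP; split; [exact: I_sub_Hp|exact: finite_dimensional_Hp_sub_I].
Qed.

Lemma finite_dimensional_FBL_eq_Hw : finite_dimensional E -> FBL p E = Hw_space E.
Proof.
move=> /finite_dimensional_biorthogonal[n [x [f [fx span]]]].
by apply/seteqP; split; [exact: FBL_sub_Hw|exact: (Hw_sub_FBL fx)].
Qed.

Lemma FBL_sub_I_finite_dimensional : FBL p E `<=` I_space E -> finite_dimensional E.
Proof.
move=> FI; have [[n [x [f [_ span]]]]|[x [f [x1 fx]]]] := @biorthogonal_dichotomy R E.
  exact: spanning_finite_dimensional span.
by case: (infinite_dimensional_FBL_nsub_I p1 x1 fx).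
Qed.

Lemma Hw_sub_Hp_finite_dimensional : Hw_space E `<=` Hp_space p E -> finite_dimensional E.
Proof.
move=> HH; have [[n [x [f [_ span]]]]|[x [f [x1 fx]]]] := @biorthogonal_dichotomy R E.
  exact: spanning_finite_dimensional span.
by case: (infinite_dimensional_Hw_nsub_Hp p1 x1 fx).
Qed.

Lemma Jpw_ideal : order_ideal_of (Hp_space p E) (Jpw_space p E).
Proof.
apply: ideal_generated_ideal; last by move=> f [].
by have [_ lin solid] := @Hp_ideal R p E p1; split=> // f g [Hf _]; exact: solid.
Qed.

Lemma Hpw_sub_Jpw : Hpw_space p E `<=` Jpw_space p E.
Proof. by move=> f Hf A [_]; apply. Qed.

Lemma I_sub_Jpw : I_space E `<=` Jpw_space p E.
Proof.
move=> f If; have [_ lin solid] := Jpw_ideal.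
have [_ [s fs]] := (I_spaceP f).1 If.
have sub : sublattice_of (Hp_space p E) (Hpw_space p E).
  by apply: sublattice_Hw; exact: Hp_sublattice.
have J : Jpw_space p E (fun xs => \sum_(x <- s) `|xs x|).
  apply: (linear_subspace_sum (F := fun x (xs : dual E) => `|xs x|) s lin) => x.
  apply: Hpw_sub_Jpw; apply: (sublattice_abs sub).
  by split; [apply: deltas_sub_Hp|apply: deltas_sub_Hw] => //; exists x.
apply: (solid _ _ _ J); first exact: (I_sub_Hp p1 If).
by move=> xs; rewrite (ger0_norm (sumr_ge0 _ _)).
Qed.

End Equivalences.

Unset Implicit Arguments.

Theorem theorem3p5 (R : realType) (E : completeNormedModType R) (p : R)
    (hp : 1 <= p) :
  [<-> finite_dimensional E;
       FBL p E = Hw_space E;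
       Hw_space E `<=` Hp_space p E;
       I_space E = Hp_space p E;
       I_space E = Jpw_space p E;
       closed_in_Hp p (I_space E);
       FBL p E `<=` I_space E;
       Iw_space E = Hw_space E;
       closed_in_Hp p (Iw_space E);
       FBL p E `<=` Iw_space E].
Proof.
have FHw := @FBL_sub_Hw R E p hp.
have FHp := @FBL_sub_Hp R p E hp.
have FIw_fin : FBL p E `<=` Iw_space E -> finite_dimensional E.
  by move=> FI; apply: (FBL_sub_I_finite_dimensional hp) => f /FI[].
tfae.
- exact: finite_dimensional_FBL_eq_Hw.
- by move=> <-.
- by move=> /Hw_sub_Hp_finite_dimensional-/(_ hp) fE; exact: finite_dimensional_I_eq_Hp.
- move=> IH; apply/seteqP; split; first exact: I_sub_Jpw.
  by rewrite IH => f; have [+ _ _] := @Jpw_ideal R E p hp; apply.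
- move=> IJ; rewrite (finite_dimensional_I_eq_Hp hp); first exact: Hp_closed.
  apply: (FBL_sub_I_finite_dimensional hp); rewrite IJ => f Ff.
  by apply: Hpw_sub_Jpw; split; [exact: FHp|exact: FHw].
- move=> cI; apply: FBL_least => //; first exact: I_sublattice_Hp.
  exact: deltas_sub_I.
- move=> /(FBL_sub_I_finite_dimensional hp) fE; apply/seteqP; split=> [f []//|f Hf].
  split=> //; rewrite (finite_dimensional_I_eq_Hp hp fE); apply: FHp.
  by rewrite (finite_dimensional_FBL_eq_Hw hp fE).
- move=> IwHw; have fE : finite_dimensional E by apply: FIw_fin; rewrite IwHw.
  by rewrite /Iw_space (finite_dimensional_I_eq_Hp hp fE); exact: Hpw_closed.
- move=> cI; apply: FBL_least => //; first exact/sublattice_Hw/I_sublattice_Hp.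
  by move=> f df; split; [exact: deltas_sub_I|exact: deltas_sub_Hw].
- exact: FIw_fin.
Qed.
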